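(* Let $(G_n)$ be a sequence of threshold graphs such that $v(G_n)\to\infty$. Then $G_n$ converges in $\overline{\mathcal U}$ as $n\to\infty$ if and only if the degree distributions $\nu(G_n)$ converge (weakly) to some distribution $\mu\in\mathcal P$. In this case, $\mu\in\mathcal P_{\mathsf s}$ and $G_n\to\Gamma_\mu$.
   Context: Graphs are finite, simple, with at least one vertex; $v(G)=|V(G)|$. A graph is a threshold graph if there are real weights $w_i$ on the vertices and $t\in\mathbb R$ such that distinct $i,j$ are adjacent iff $w_i+w_j>t$. For graphs $F,G$, $t(F,G)$ is the probability that a uniformly random map $V(F)\to V(G)$ is a graph homomorphism. Let $\mathcal U$ be the countable set of unlabeled graphs and $\overline{\mathcal U}$ the compact metric space obtained as the closure of the image of $\mathcal U$ under the embedding $G\mapsto\big((t(F,G))_{F\in\mathcal U},1/v(G)\big)$ into $[0,1]^{\mathcal U}\times[0,1]$. Elements of $\mathcal U_\infty:=\overline{\mathcal U}\setminus\mathcal U$ are called graph limits. The functionals $t(F,\cdot)$ extend continuously to $\overline{\mathcal U}$; a sequence with $v(G_n)\to\infty$ converges in $\overline{\mathcal U}$ iff $t(F,G_n)$ converges for every graph $F$, and $G_n\to\Gamma\in\mathcal U_\infty$ iff $v(G_n)\to\infty$ and $t(F,G_n)\to t(F,\Gamma)$ for every $F$. For a symmetric measurable $W:[0,1]^2\to[0,1]$, $\Gamma_W\in\mathcal U_\infty$ is the graph limit with $t(F,\Gamma_W)=\int_{[0,1]^{v(F)}}\prod_{ij\in E(F)}W(x_i,x_j)\,dx_1\cdots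 dx_{v(F)}$ for every graph $F$. $\mathcal P$ is the set of probability measures on $[0,1]$ with the weak topology. $\nu(G)\in\mathcal P$ is the normalized degree distribution of a graph $G$, i.e. the distribution of $d_G(v)/v(G)$ for a uniformly random vertex $v$ of $G$. For $\mu\in\mathcal P$ put $F_\mu(x-)=\mu([0,x))$ and $S_\mu:=\{(x,y)\in[0,1]^2: x\ge F_\mu((1-y)-)\}$. For $S\subseteq[0,1]^2$, $S^\dagger:=\{(x,y):(y,x)\in S\}$. $\mathcal P_{\mathsf s}:=\{\mu\in\mathcal P:S_\mu=S_\mu^\dagger\}$, and for $\mu\in\mathcal P_{\mathsf s}$, $\Gamma_\mu:=\Gamma_{W_\mu}$ with $W_\mu:=\mathbf 1_{S_\mu}$. *)

(* Defs.v *)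
From HB Require Import structures.
From mathcomp Require Import all_boot all_order all_algebra.
From mathcomp Require Import all_classical all_reals all_analysis.
From mathcomp Require Import measurable_realfun.

Set Implicit Arguments.
Unset Strict Implicit.
Unset Printing Implicit Defensive.

Import Order.TTheory GRing.Theory Num.Theory.
Import numFieldNormedType.Exports.

Local Open Scope classical_set_scope.
Local Open Scope ring_scope.

(* A graph has vertex set 'I_n with 0 < n; the edge set is stored as a
   symmetric irreflexive set of ordered pairs. *)
Definition simple_edges (n : nat) (E : {set 'I_n * 'I_n}) : bool :=
  [forall i, (i, i) \notin E] &&
  [forall i, forall j, ((i, j) \in E) ==> ((j, i) \in E)].

Definition graph : Type :=
  {A : {n : nat & {set 'I_n * 'I_n}} | (0 < tag A)%N && simple_edges (tagged A)}.

HB.instance Definition _ := Choice.on graph.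

Definition order_graph (G : graph) : nat := tag (val G).

Definition vertex (G : graph) : finType := 'I_(order_graph G).

Definition adj (G : graph) : rel (vertex G) :=
  fun i j => (i, j) \in tagged (val G).

Definition deg (G : graph) (i : vertex G) : nat := #|[pred j | adj i j]|.

Definition threshold_graph (R : realType) (G : graph) : Prop :=
  exists (w : vertex G -> R) (t : R),
    forall i j, i != j -> adj i j = (t < w i + w j).

Definition isomorphic (G H : graph) : bool :=
  [exists f : {ffun vertex G -> vertex H},
    [exists g : {ffun vertex H -> vertex G},
      [&& [forall i, g (f i) == i], [forall i, f (g i) == i]
        & [forall i, forall j, adj (f i) (f j) == adj i j]]]].

Lemma isomorphicP (G H : graph) :
  reflect (exists (f : vertex G -> vertex H) (g : vertex H -> vertex G),
    [/\ cancel f g, cancel g f & forall i j, adj (f i) (f j) = adj i j])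
    (isomorphic G H).
Proof.
apply: (iffP existsP) => [[f /existsP[g /and3P[/forallP fg /forallP gf /forallP h]]]|
    [f [g [fg gf h]]]].
  exists f, g; split=> [i|i|i j]; [exact/eqP|exact/eqP|].
  by have /forallP/(_ j)/eqP := h i.
exists [ffun i => f i]; apply/existsP; exists [ffun i => g i].
apply/and3P; split; apply/forallP => i; rewrite ?ffunE ?fg ?gf//.
by apply/forallP => j; rewrite !ffunE h.
Qed.

Lemma isomorphic_refl : reflexive isomorphic.
Proof. by move=> G; apply/isomorphicP; exists id, id. Qed.

Lemma isomorphic_sym : symmetric isomorphic.
Proof.
have imp G H : isomorphic G H -> isomorphic H G.
  case/isomorphicP => f [g [fg gf h]]; apply/isomorphicP; exists g, f.
  by split=> // i j; rewrite -h !gf.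
by move=> G H; apply/idP/idP; exact: imp.
Qed.

Lemma isomorphic_trans : transitive isomorphic.
Proof.
move=> H G K /isomorphicP[f [g [fg gf h]]] /isomorphicP[f' [g' [fg' gf' h']]].
apply/isomorphicP; exists (f' \o f), (g \o g').
by split; [exact: can_comp|exact: can_comp|move=> i j; rewrite /= h' h].
Qed.

Definition isomorphic_equiv : equiv_rel graph :=
  EquivRel isomorphic isomorphic_refl isomorphic_sym isomorphic_trans.

(* Unlabeled graphs: isomorphism classes *)
Definition ugraph : Type := {eq_quot isomorphic_equiv}%qT.

HB.instance Definition _ := Choice.on ugraph.

Definition unlabeled (G : graph) : ugraph :=
  (\pi_({eq_quot isomorphic_equiv}) G)%qT.

Definition representative (F : ugraph) : graph :=
  repr (F : {eq_quot isomorphic_equiv}%qT).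

Definition is_hom (F G : graph) (f : {ffun vertex F -> vertex G}) : bool :=
  [forall i, forall j, adj i j ==> adj (f i) (f j)].

Definition hom_density (R : realType) (F G : graph) : R :=
  #|[pred f : {ffun vertex F -> vertex G} | is_hom f]|%:R /
  #|{: {ffun vertex F -> vertex G}}|%:R.

(* [0,1]^U x [0,1] sits as a closed subspace in R^U x R, both with the product
   topology; closures and limits are taken in the latter. *)
Definition graph_space (R : realType) : topologicalType :=
  ({ptws ugraph -> R} * R)%type.

Definition embed (R : realType) (G : ugraph) : graph_space R :=
  ((fun F : ugraph => hom_density R (representative F) (representative G)),
   ((order_graph (representative G))%:R : R)^-1).

Definition Ubar (R : realType) : set (graph_space R) :=
  closure (range (@embed R)).

Arguments Ubar : clear implicits.

Definition Uinfty (R : realType) : set (graph_space R) :=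
  Ubar R `\` range (@embed R).

Arguments Uinfty : clear implicits.

Definition unit_square (R : realType) : set (R * R) :=
  [set p | 0 <= p.1 <= 1 /\ 0 <= p.2 <= 1].

Definition is_graphon (R : realType) (W : R * R -> R) : Prop :=
  [/\ measurable_fun (@unit_square R) W,
      forall p, @unit_square R p -> 0 <= W p <= 1
    & forall x y, @unit_square R (x, y) -> W (x, y) = W (y, x)].

Section product_probability.
Context d (T : measurableType d) (R : realType) (P : probability T R).

Definition tuple_cons (n : nat) (p : T * n.-tuple T) : n.+1.-tuple T :=
  [the n.+1.-tuple T of p.1 :: p.2].

Lemma measurable_tuple_cons n : measurable_fun [set: T * n.-tuple T] (@tuple_cons n).
Proof.
by apply: measurable_cons; [exact: measurable_fst|exact: measurable_snd].
Qed.

HB.instance Definition _ n :=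
  isMeasurableFun.Build _ _ _ _ (@tuple_cons n) (@measurable_tuple_cons n).

(* The n-fold product of P *)
Fixpoint tuple_prob (n : nat) : probability (n.-tuple T) R :=
  match n with
  | 0 => dirac [tuple]
  | n'.+1 => distribution (P \x tuple_prob n')%E (@tuple_cons n')
  end.

End product_probability.

(* uniform_prob (@ltr01 R) is Lebesgue measure restricted to [0,1] *)
Definition cube_measure (R : realType) (n : nat) :=
  tuple_prob (uniform_prob (@ltr01 R)) n.

Definition unit_cube (R : realType) (n : nat) : set (n.-tuple (measurableTypeR R)) :=
  [set x | forall i, 0 <= tnth x i <= 1].

(* t(F, Gamma_W); the product is over unordered edges, each represented by its
   pair (i, j) with i < j. *)
Definition graphon_density (R : realType) (F : graph) (W : R * R -> R) : R :=
  \int[@cube_measure R (order_graph F)]_(x in @unit_cube R (order_graph F))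
    \prod_(e : vertex F * vertex F | ((e.1 < e.2)%N) && adj e.1 e.2)
      W (tnth x e.1, tnth x e.2).

(* Gamma_W, a point of graph_space with last coordinate lim 1/v(G_n) = 0; it is
   meant for W satisfying is_graphon, and only W on [0,1]^2 matters. *)
Definition graphon_limit (R : realType) (W : R * R -> R) : graph_space R :=
  ((fun F : ugraph => graphon_density (representative F) W), 0).

(* Probability measures on [0,1], as Borel probabilities on R carried by [0,1] *)
Record prob01 (R : realType) := Prob01 {
  prob01_measure :> probability (measurableTypeR R) R;
  prob01_support : prob01_measure (`[0, 1]%classic : set R) = 1%E }.

Definition weakly_converges (R : realType) (mu_ : nat -> prob01 R) (mu : prob01 R)
    : Prop :=
  forall f : R -> R, {within `[0, 1], continuous f} ->
    (fun n => \int[mu_ n]_(x in `[0, 1]) f x) @ \oo --> \int[mu]_(x in `[0, 1]) f x.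

Section degree_distribution.
Context (R : realType) (G : graph).

Definition normalized_degree (i : vertex G) : measurableTypeR R :=
  (deg i)%:R / (order_graph G)%:R.

Definition degree_measure (A : set (measurableTypeR R)) : \bar R :=
  (((order_graph G)%:R^-1)%:E * \sum_(i : vertex G) \d_(normalized_degree i) A)%E.

Lemma order_graph_gt0 : (0 < order_graph G)%N.
Proof. by have /andP[] := valP G. Qed.

Let degree_measure0 : degree_measure set0 = 0%E.
Proof. by rewrite /degree_measure big1 ?mule0// => i _; rewrite measure0. Qed.

Let degree_measure_ge0 A : (0 <= degree_measure A)%E.
Proof.
by apply: mule_ge0; [rewrite lee_fin invr_ge0|exact: sume_ge0].
Qed.

Let order_graph_inv_ge0 : 0 <= ((order_graph G)%:R^-1 : R).
Proof. by rewrite invr_ge0. Qed.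

Let degree_measureE : degree_measure =
  mscale (NngNum order_graph_inv_ge0) (msum (fun k =>
    if insub k is Some i then \d_(normalized_degree i) else mzero) (order_graph G)).
Proof.
apply/funext => A; rewrite /degree_measure /mscale/= /msum; congr (_ * _)%E.
by apply: eq_bigr => i _; rewrite valK.
Qed.

Let degree_measure_sigma_additive : semi_sigma_additive degree_measure.
Proof. by rewrite degree_measureE; exact: measure_semi_sigma_additive. Qed.

HB.instance Definition _ := isMeasure.Build _ _ _ degree_measure
  degree_measure0 degree_measure_ge0 degree_measure_sigma_additive.

Lemma degree_measure_full A : (forall i, A (normalized_degree i)) ->
  degree_measure A = 1%E.
Proof.
move=> AT; rewrite /degree_measure (eq_bigr (fun=> 1%:E)); last first.
  by move=> i _; rewrite diracE mem_set.
rewrite sumEFin -EFinM sumr_const card_ord mulVf// pnatr_eq0.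
by rewrite -lt0n order_graph_gt0.
Qed.

Let degree_measureT : degree_measure [set: _] = 1%E.
Proof. exact: degree_measure_full. Qed.

HB.instance Definition _ := Measure_isProbability.Build _ _ _
  degree_measure degree_measureT.

Let degree_measure_support :
  degree_measure (`[0, 1]%classic : set R) = 1%E.
Proof.
apply: degree_measure_full => i; rewrite /normalized_degree /= in_itv/=.
rewrite divr_ge0//= ler_pdivrMr ?ltr0n ?order_graph_gt0// mul1r ler_nat.
by rewrite -[leqRHS]card_ord max_card.
Qed.

Definition degree_distribution : prob01 R := Prob01 degree_measure_support.

End degree_distribution.

Definition Fminus (R : realType) (mu : prob01 R) (x : R) : R :=
  fine (mu (`[0, x[%classic : set R)).

Definition S_mu (R : realType) (mu : prob01 R) : set (R * R) :=
  @unit_square R `&` [set p | Fminus mu (1 - p.2) <= p.1].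

Definition dagger (R : realType) (S : set (R * R)) : set (R * R) :=
  [set p | S (p.2, p.1)].

Definition P_s (R : realType) : set (prob01 R) :=
  [set mu | S_mu mu = dagger (S_mu mu)].

(* W_mu and Gamma_mu are meant for mu in P_s, where W_mu is a graphon
   (is_graphon_W_mu). *)
Definition W_mu (R : realType) (mu : prob01 R) : R * R -> R := \1_(S_mu mu).

Definition Gamma_mu (R : realType) (mu : prob01 R) : graph_space R :=
  graphon_limit (W_mu mu).

Lemma Fminus_nondecreasing (R : realType) (mu : prob01 R) :
  {homo Fminus mu : x y / x <= y}.
Proof.
move=> x y xy; rewrite /Fminus fine_le// ?fin_num_measure//.
apply: le_measure; rewrite ?inE// => z /=; rewrite !in_itv/= => /andP[-> zx].
exact: lt_le_trans xy.
Qed.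

Lemma measurable_unit_square (R : realType) : measurable (@unit_square R).
Proof.
rewrite [X in measurable X](_ : _ = `[0, 1]%classic `*` `[0, 1]%classic).
  exact: measurableX.
by apply/seteqP; split => -[x y] /=; rewrite !in_itv.
Qed.

Lemma measurable_S (R : realType) (mu : prob01 R) : measurable (S_mu mu).
Proof.
apply: measurableI; first exact: measurable_unit_square.
have mF : measurable_fun [set: R * R] (fun p => Fminus mu (1 - p.2)).
  apply: (@measurableT_comp _ _ _ _ _ _ (Fminus mu)).
    exact: (nondecreasing_measurable _ (Fminus_nondecreasing mu)).
  by apply: measurable_funB => //; exact: measurable_snd.
have := measurable_fun_ler mF (@measurable_fst _ _ R R).
move=> /(_ measurableT [set true] I).
by rewrite setTI.
Qed.

Lemma is_graphon_W_mu (R : realType) (mu : prob01 R) :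
  P_s mu -> is_graphon (W_mu mu).
Proof.
move=> Smu; split.
- by apply: measurable_indic; exact: measurable_S.
- by move=> p _; rewrite /W_mu indicE; case: (_ \in _); rewrite ?lexx ler01.
- move=> x y _; rewrite /W_mu !indicE; congr ((nat_of_bool _)%:R).
  by rewrite [in RHS]Smu; apply/idP/idP; rewrite !inE.
Qed.

(* Main.v *)
Require Import Defs.
From mathcomp Require Import all_boot all_order all_algebra.
From mathcomp Require Import all_classical all_reals all_analysis.
From mathcomp Require Import measurable_realfun lra zify.

(** Sort the [n] vertices of a threshold graph by weight and spread them over
    [[0,1)], vertex number [a] occupying [[a/n, (a+1)/n)]. Neighbourhoods are
    then final segments of this order, up to the vertex itself. Hence, up to
    errors of order [1/n], the points [x] and [y] lie over adjacent vertices
    exactly when the normalized degree at [x] is at least [1 - y], that is,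
    when [F(1 - y) <= x], where [F] is the left-continuous distribution
    function of the degree distribution (lemmas [threshold_nested_order],
    [Fminus_vertex_at], [adj_vertex_at] and [not_adj_vertex_at]). A threshold
    graph is therefore essentially recovered from its degree distribution.

    Suppose that the degree distributions converge weakly to [mu]. Comparing
    indicators of intervals with continuous ramps shows that the distribution
    functions converge up to an arbitrarily small shift of the argument, so the
    adjacency of the vertices over [x] and [y] is eventually that prescribed by
    [S_mu], unless [x = y] or [x] lies in the jump of [F_mu] at [1 - y]
    ([near_adj], [near_not_adj]). The symmetry of adjacency passes to [S_mu],
    because the strict inequalities needed here can be reached by moving points
    of [S_mu] slightly ([S_mu_sym]). The exceptional pairs form a null set:
    unless [x] is one of the countably many values of [F_mu] at rational
    points, it lies in the jump at [1 - y] for at most one [y]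
    ([ambiguous_unique]). A homomorphism density is the integral over the cube of a
    product of adjacencies of the vertices over the coordinates, so dominated
    convergence gives the convergence of [G_n] to [Gamma_mu].

    Conversely, the [k]-th moment of the degree distribution of [G] is the
    density in [G] of a star with [k] leaves, so the convergence of the graphs
    implies that of the integrals of all polynomials of the degree. The degree
    as a function of the position [x] is nondecreasing. If at [x] it does not
    converge, then it is below and above some rational number [c] infinitely
    often, and the polynomials [(1 - t^m)^K], with [K] about [c^-m], which
    approximate the indicator of [t < c], force [x] to be the limit of their
    limit integrals, a number which depends on [c] only
    ([limit_moment_cutoff]). So the degree functions converge outside a
    countable set, and the law of their limit under Lebesgue measure is the
    weak limit of the degree distributions ([weak_limit]). *)

Set Implicit Arguments.
Unset Strict Implicit.
Unset Printing Implicit Defensive.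

Import Order.TTheory GRing.Theory Num.Theory.
Import numFieldNormedType.Exports.

Local Open Scope classical_set_scope.
Local Open Scope ring_scope.

(** * Isomorphism invariance and convergence of graphs *)

Lemma adj_irrefl (G : graph) : irreflexive (@adj G).
Proof.
move=> i; apply/negbTE.
by have /andP[_ /andP[/forallP/(_ i)]] := valP G.
Qed.

Lemma adj_sym (G : graph) : symmetric (@adj G).
Proof.
have imp i j : @adj G i j -> adj j i.
  by have /andP[_ /andP[_ /forallP/(_ i)/forallP/(_ j)/implyP]] := valP G.
by move=> i j; apply/idP/idP; exact: imp.
Qed.

Lemma isomorphic_order (G H : graph) : isomorphic G H ->
  order_graph G = order_graph H.
Proof.
move=> /isomorphicP[f [g [fg gf _]]].
have := bij_eq_card (Bijective fg gf).
by rewrite !card_ord.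
Qed.

Lemma hom_density_isomorphic (R : realType) (F F' G G' : graph) :
  isomorphic F F' -> isomorphic G G' ->
  hom_density R F G = hom_density R F' G'.
Proof.
move=> FF' GG'; rewrite /hom_density !card_ffun !card_ord.
rewrite (isomorphic_order FF') (isomorphic_order GG'); congr (_%:R / _).
move/isomorphicP: FF' => [f [g [fg gf fadj]]].
move/isomorphicP: GG' => [f' [g' [fg' gf' fadj']]].
pose to (h : {ffun vertex F -> vertex G}) : {ffun vertex F' -> vertex G'} :=
  [ffun i => f' (h (g i))].
pose from (h : {ffun vertex F' -> vertex G'}) : {ffun vertex F -> vertex G} :=
  [ffun i => g' (h (f i))].
have toK : cancel to from by move=> h; apply/ffunP => i; rewrite !ffunE fg' fg.
have fromK : cancel from to by move=> h; apply/ffunP => i; rewrite !ffunE gf' gf.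
rewrite -!sum1_card (reindex to) /=; last by exists from => ? _.
apply: eq_bigl => h; rewrite !inE.
apply/forallP/forallP => hom i; apply/forallP => j; apply/implyP => ij.
- by rewrite !ffunE fadj'; have /forallP/(_ (g j))/implyP := hom (g i);
    apply; rewrite -fadj !gf.
- have /forallP/(_ (f j))/implyP := hom (f i).
  by rewrite !ffunE fadj' !fg fadj; apply.
Qed.

Lemma representative_unlabeled (G : graph) :
  isomorphic (representative (unlabeled G)) G.
Proof.
rewrite /representative /unlabeled.
have : (\pi_({eq_quot isomorphic_equiv}) (repr (\pi_({eq_quot isomorphic_equiv}) G))
  = \pi_({eq_quot isomorphic_equiv}) G)%qT by rewrite reprK.
by move/eqmodP.
Qed.

(** The first factor of the ambient space carries the topology of pointwise
    convergence, and both coordinates are invariant under isomorphism, so the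
    chosen representatives of the classes can be replaced by the graphs. *)
Lemma embed_cvgP (R : realType) (G : nat -> graph) (Gamma : graph_space R) :
  ((fun n => embed R (unlabeled (G n))) @ \oo --> Gamma) <->
  (forall F : ugraph,
    (fun n => hom_density R (representative F) (G n)) @ \oo --> Gamma.1 F) /\
  (fun n => ((order_graph (G n))%:R : R)^-1) @ \oo --> Gamma.2.
Proof.
pose u n := embed R (unlabeled (G n)).
have u1 F n : (u n).1 F = hom_density R (representative F) (G n).
  apply: hom_density_isomorphic; first exact: isomorphic_refl.
  exact: representative_unlabeled.
have u2 n : (u n).2 = ((order_graph (G n))%:R : R)^-1.
  by rewrite /u /= (isomorphic_order (representative_unlabeled _)).
split.
- move=> cu; split.
  + have cu1 : (fun n => (u n).1) @ \oo --> Gamma.1.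
      exact: (cvg_comp _ _ cu (@cvg_fst _ _ (nbhs Gamma.1) (nbhs Gamma.2) _)).
    move=> F; under eq_fun do rewrite -u1.
    exact: cvg_comp _ _ cu1 (@proj_continuous ugraph (fun=> R) F Gamma.1).
  + under eq_fun do rewrite -u2.
    exact: (cvg_comp _ _ cu (@cvg_snd _ _ (nbhs Gamma.1) (nbhs Gamma.2) _)).
- move=> [c1 c2].
  have d1 : (fun n => (u n).1) @ \oo --> Gamma.1.
    apply/(@cvg_sup _ _ (fun F : ugraph =>
      Topological.class (initial_topology (fun f : ugraph -> R => f F)))) => F U.
    rewrite nbhsE => -[B [[C oC <-] CF] BU].
    apply: (filterS BU) => /=.
    have c1F : (fun n => (u n).1 F) @ \oo --> Gamma.1 F.
      by rewrite (funext (u1 F)); exact: c1.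
    by apply: c1F; exact: open_nbhs_nbhs.
  have d2 : (fun n => (u n).2) @ \oo --> Gamma.2.
    by under eq_fun do rewrite u2.
  move: Gamma {c1 c2} d1 d2 => [g l] d1 d2.
  exact: (cvg_pair d1 d2).
Qed.

(** * Stars and moments of the degree distribution *)

Definition star_edges (k : nat) : {set 'I_k.+1 * 'I_k.+1} :=
  [set e | (e.1 == ord0) != (e.2 == ord0)].

Lemma star_edges_simple k : simple_edges (star_edges k).
Proof.
apply/andP; split; apply/forallP => i; first by rewrite inE eqxx.
by apply/forallP => j; apply/implyP; rewrite !inE eq_sym.
Qed.

Definition star (k : nat) : graph :=
  exist (fun A : {n : nat & {set 'I_n * 'I_n}} =>
           (0 < tag A)%N && simple_edges (tagged A))
    (existT (fun n => {set 'I_n * 'I_n}) k.+1 (star_edges k))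
    (star_edges_simple k).

Lemma adj_star k (i j : vertex (star k)) :
  adj i j = ((i == ord0 :> 'I_k.+1) != (j == ord0 :> 'I_k.+1)).
Proof. by rewrite /adj inE. Qed.

Lemma is_hom_star k (G : graph) (f : {ffun vertex (star k) -> vertex G}) :
  is_hom f = [forall i, (i != ord0 :> 'I_k.+1) ==> adj (f ord0) (f i)].
Proof.
apply/forallP/forallP => hom i.
- apply/implyP => i0; have /forallP/(_ i)/implyP := hom ord0; apply.
  by rewrite adj_star eqxx (negbTE i0).
- apply/forallP => j; apply/implyP; rewrite adj_star.
  have [->|i0] := eqVneq i ord0; have [->|j0] := eqVneq j ord0 => //= _.
  + by have /implyP := hom j; exact.
  + by rewrite adj_sym; have /implyP := hom i; exact.
Qed.

(** A homomorphism from a star is the choice of an image [c] of the centre and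
    of a neighbour of [c] for each leaf. In the proof, [step c] encodes these
    two constraints as factors, so that the sum over all maps becomes a product
    of sums. *)
Lemma card_hom_star k (G : graph) :
  #|[pred f : {ffun vertex (star k) -> vertex G} | is_hom f]| =
  (\sum_(c : vertex G) deg c ^ k)%N.
Proof.
pose step (c : vertex G) (i : 'I_k.+1) (v : vertex G) : nat :=
  if i == ord0 then (v == c) else adj c v.
transitivity (\sum_(c : vertex G)
  \sum_(f : {ffun 'I_k.+1 -> vertex G}) \prod_i step c i (f i))%N.
  rewrite exchange_big /= -sum1_card [in LHS]big_mkcond /=; apply: eq_bigr => f _.
  rewrite (bigD1 (f ord0)) //= [X in (_ + X)%N]big1 ?addn0; last first.
    move=> c cf; rewrite (bigD1 ord0) //= /step eqxx.
    by rewrite eq_sym (negbTE cf).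
  rewrite inE is_hom_star (bigD1 ord0) //= {1}/step !eqxx mul1n.
  case: ifPn => [/forallP hom|/forallPn[i]].
    rewrite big1 // => i i0; rewrite /step (negbTE i0).
    by have /implyP -> := hom i.
  rewrite negb_imply => /andP[i0 /negbTE nadj].
  by rewrite (bigD1 i) //= /step (negbTE i0) nadj.
apply: eq_bigr => c _.
rewrite -(bigA_distr_bigA (step c)) big_ord_recl /=.
rewrite (bigD1 c) //= {1}/step !eqxx big1 ?addn0 ?mul1n; last first.
  by move=> v vc; rewrite /step eqxx (negbTE vc).
rewrite (eq_bigr (fun=> deg c)) => [|i _]; last first.
  rewrite /deg -sum1_card [in RHS]big_mkcond /=; apply: eq_bigr => v _.
  by rewrite /step /= inE; case: adj.
by rewrite prod_nat_const card_ord.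
Qed.

(** Star densities are the moments of the degree distribution. *)
Lemma hom_density_star (R : realType) k (G : graph) :
  hom_density R (star k) G =
  (order_graph G)%:R^-1 * \sum_(i : vertex G) ((deg i)%:R / (order_graph G)%:R) ^+ k.
Proof.
rewrite /hom_density card_hom_star card_ffun !card_ord.
under [in RHS]eq_bigr do rewrite expr_div_n.
rewrite -mulr_suml natr_sum mulrCA natrX exprS invfM; congr (_ * _).
by apply: eq_bigr => i _; rewrite natrX.
Qed.

(** * Threshold graphs are nested *)

(** If [w i <= w j], then sending [j] to [i] and fixing every other vertex maps
    the neighbours of [i] injectively to neighbours of [j]. *)
Lemma threshold_deg_le (R : realType) (G : graph) (w : vertex G -> R) (t : R) :
  (forall i j, i != j -> adj i j = (t < w i + w j)) ->
  forall i j, w i <= w j -> (deg i <= deg j)%N.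
Proof.
move=> wE i j wij.
pose f (k : vertex G) := if k == j then i else k.
rewrite /deg -(card_in_imset (f := f)) => [|k l]; last first.
  rewrite !inE /f => ik il; have [->|_] := eqVneq k j; have [->|_] := eqVneq l j => //.
  + by move=> il'; move: il; rewrite -il' adj_irrefl.
  + by move=> ki; move: ik; rewrite ki adj_irrefl.
apply: subset_leq_card; apply/fintype.subsetP => _ /imsetP[k + ->]; rewrite !inE /f => ik.
have [kj|kj] := eqVneq k j; first by rewrite adj_sym -kj.
have ik' : i != k by apply: contraTneq ik => ->; rewrite adj_irrefl.
rewrite wE 1?eq_sym//; move: ik; rewrite wE// => /lt_le_trans; apply.
by rewrite lerD2r.
Qed.

(** What is retained of a threshold graph: in the order [s], the neighbours of
    the vertex in position [a] are the last vertices, as many as its degree.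
    Because a vertex is not its own neighbour, this holds only up to one
    position, whence the successor in the last clause. *)
Definition nested_order (G : graph) (s : seq (vertex G)) : Prop :=
  perm_eq s (enum (vertex G)) /\
  forall i0 a b, (a < order_graph G)%N -> (b < order_graph G)%N ->
  [/\ (a <= b)%N -> (deg (nth i0 s a) <= deg (nth i0 s b))%N,
      a != b -> (order_graph G <= deg (nth i0 s a) + b)%N ->
        adj (nth i0 s a) (nth i0 s b)
    & adj (nth i0 s a) (nth i0 s b) ->
        (order_graph G <= (deg (nth i0 s a) + b).+1)%N].

Section nested_order_facts.
Context (G : graph) (s : seq (vertex G)).
Hypothesis ps : perm_eq s (enum (vertex G)).

Lemma size_order : size s = order_graph G.
Proof. by rewrite (perm_size ps) -cardE card_ord. Qed.

Lemma mem_order i : i \in s.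
Proof. by rewrite (perm_mem ps) mem_enum. Qed.

Lemma uniq_order : uniq s.
Proof. by rewrite (perm_uniq ps) enum_uniq. Qed.

Lemma index_order_lt i : (index i s < order_graph G)%N.
Proof. by rewrite -size_order index_mem mem_order. Qed.

Lemma card_index_lt k : (k <= order_graph G)%N ->
  #|[pred i | (index i s < k)%N]| = k.
Proof.
move=> kn; rewrite -[RHS](size_takel (s := s)) ?size_order//.
have /card_uniqP <- : uniq (take k s) by rewrite take_uniq// uniq_order.
by apply: eq_card => i; rewrite inE in_take// mem_order.
Qed.

Lemma card_index_ge k : #|[pred i | (k <= index i s)%N]| = (order_graph G - k)%N.
Proof.
have [kn|/ltnW nk] := leqP k (order_graph G).
  have := cardC [pred i | (index i s < k)%N].
  rewrite card_index_lt// card_ord => <-; rewrite addKn.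
  by apply: eq_card => i; rewrite !inE leqNgt.
rewrite (eqP nk); apply: eq_card0 => i; rewrite !inE; apply/negbTE.
by rewrite -ltnNge (leq_trans _ nk)// index_order_lt.
Qed.

End nested_order_facts.

(** For the order by weight, a vertex which is not adjacent to the one in
    position [b] has all its neighbours after [b], and a vertex adjacent to it is
    adjacent to all the later ones except itself; counting positions gives
    the bounds on the degree. *)
Lemma threshold_nested_order (R : realType) (G : graph) :
  threshold_graph R G -> exists s : seq (vertex G), nested_order s.
Proof.
move=> [w [t wE]].
pose le_w := fun i j => w i <= w j.
have le_w_total : total le_w by move=> i j; exact: le_total.
have le_w_trans : transitive le_w by move=> j i k; exact: le_trans.
exists (sort le_w (enum (vertex G))).
set s := sort _ _; have ps : perm_eq s (enum (vertex G)) by rewrite /s perm_sort.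
split=> // i0 a b an bn.
have ws c d : (c <= d)%N -> (d < order_graph G)%N -> w (nth i0 s c) <= w (nth i0 s d).
  move=> cd dn; apply: (sorted_leq_nth le_w_trans _ i0 (sort_sorted le_w_total _)) => //.
  + by move=> ?; exact: lexx.
  + by rewrite inE (size_order ps) (leq_ltn_trans cd).
  + by rewrite inE (size_order ps).
have nthK c : (c < order_graph G)%N -> index (nth i0 s c) s = c.
  by move=> cn; rewrite index_uniq ?(size_order ps) ?(uniq_order ps).
have w_index i d : (index i s <= d)%N -> (d < order_graph G)%N -> w i <= w (nth i0 s d).
  by move=> id dn; rewrite -(nth_index i0 (mem_order ps i)) ws.
have w_index' i d : (d <= index i s)%N -> w (nth i0 s d) <= w i.
  by move=> id; rewrite -(nth_index i0 (mem_order ps i)) ws ?index_order_lt.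
split.
- by move=> ab; apply: (threshold_deg_le wE); exact: ws.
- move=> ab; apply: contraTT => nadj; rewrite -ltnNge.
  (* No neighbour of position [a] is in a position up to [b]. *)
  suff : (deg (nth i0 s a) <= order_graph G - b.+1)%N by lia.
  rewrite -(card_index_ge ps); apply: subset_leq_card.
  apply/fintype.subsetP => i; rewrite !inE ltnNge => adji; apply/negP => ib.
  move/negP: nadj; apply; rewrite wE; last first.
    by apply: contra_neq ab => /(congr1 (index^~ s)); rewrite !nthK.
  have := adji; rewrite wE; first by move/lt_le_trans; apply; rewrite lerD2l w_index.
  by apply: contraTneq adji => <-; rewrite adj_irrefl.
- move=> adjab.
  have ab : nth i0 s a != nth i0 s b by apply: contraTneq adjab => ->; rewrite adj_irrefl.
  (* From [b] on, every position is that of a neighbour or is [a] itself. *)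
  suff : (order_graph G - b <= (deg (nth i0 s a)).+1)%N by lia.
  rewrite -(card_index_ge ps).
  have <- : #|[predU1 nth i0 s a & [pred j | adj (nth i0 s a) j]]| = (deg (nth i0 s a)).+1.
    by rewrite cardU1 inE adj_irrefl.
  apply: subset_leq_card; apply/fintype.subsetP => i; rewrite !inE => bi.
  have [//|ia /=] := eqVneq i (nth i0 s a); rewrite wE 1?eq_sym//.
  by move: adjab; rewrite wE// => /lt_le_trans; apply; rewrite lerD2l w_index'.
Qed.

(** * Degrees and adjacency as functions on the unit interval *)

(** The vertex lying over the point [x]. The default value is used only for
    [1 <= x], a null event for the uniform law. *)
Definition vertex_at (R : realType) (G : graph) (s : seq (vertex G)) (x : R) : vertex G :=
  nth (Ordinal (order_graph_gt0 G)) s (Num.truncn (x * (order_graph G)%:R)).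

Lemma Fminus_degree (R : realType) (G : graph) (z : R) :
  Fminus (degree_distribution R G) z =
  #|[pred i : vertex G | (deg i)%:R / (order_graph G)%:R < z]|%:R / (order_graph G)%:R.
Proof.
rewrite /Fminus /= /degree_measure mulrC.
rewrite (eq_bigr (fun i : vertex G =>
  ((((deg i)%:R / (order_graph G)%:R < z)%R)%:R : R)%:E)); last first.
  move=> i _; rewrite diracE; congr (_%:R%:E); congr nat_of_bool.
  apply/idP/idP => [|dz]; rewrite inE/= in_itv/=; first by move/andP=> [].
  by rewrite dz andbT divr_ge0.
rewrite sumEFin -EFinM /=; congr (_ * _); rewrite -natr_sum; congr (_%:R).
by rewrite -sum1_card [in RHS]big_mkcond /=; apply: eq_bigr => i _; rewrite inE; case: ifP.
Qed.

Section step_function.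
Context (R : realType) (G : graph) (s : seq (vertex G)).
Hypothesis sG : nested_order s.
Local Notation n := (order_graph G).

Lemma truncn_order (x : R) : 0 <= x < 1 ->
  (Num.truncn (x * n%:R) < n)%N /\
  (Num.truncn (x * n%:R))%:R <= x * n%:R < (Num.truncn (x * n%:R)).+1%:R.
Proof.
move=> /andP[x0 x1]; have xn : 0 <= x * n%:R by rewrite mulr_ge0.
have xx := truncn_itv xn; split => //.
rewrite -(ltr_nat R); case/andP: xx => /le_lt_trans + _; apply.
by rewrite gtr_pMl// ltr0n order_graph_gt0.
Qed.

(** With degrees nondecreasing along [s], the vertices of normalized degree less
    than [z] form an initial segment, and [Fminus] measures its length: the
    distribution function and the degree function are inverse to each other.
    The equivalence is exact, with no error term in [n]. *)
Lemma Fminus_vertex_at (x z : R) : 0 <= x < 1 ->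
  (Fminus (degree_distribution R G) z <= x) =
  (z <= (deg (vertex_at s x))%:R / n%:R).
Proof.
move=> x01; have [an /andP[ax xa]] := truncn_order x01.
have n0 : 0 < n%:R :> R by rewrite ltr0n order_graph_gt0.
have [ps _] := sG.
rewrite Fminus_degree ler_pdivrMr// /vertex_at.
set i0 := Ordinal _; set a := Num.truncn _ in an ax xa *.
have D b c : (b <= c)%N -> (c < n)%N -> (deg (nth i0 s b) <= deg (nth i0 s c))%N.
  by move=> bc cn; have [_ /(_ i0 b c (leq_ltn_trans bc cn) cn)[]] := sG => /(_ bc).
apply/idP/idP => [|zD].
- apply: contraTT; rewrite -!ltNge => Dz; rewrite (lt_le_trans xa)// ler_nat.
  rewrite -(card_index_lt ps an); apply: subset_leq_card.
  apply/fintype.subsetP => i; rewrite !inE ltnS => ia.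
  rewrite (le_lt_trans _ Dz)// ler_pM2r ?invr_gt0// ler_nat.
  by rewrite -(nth_index i0 (mem_order ps i)) D.
- rewrite (le_trans _ ax)// ler_nat -[leqRHS](card_index_lt ps (ltnW an)).
  apply: subset_leq_card; apply/fintype.subsetP => i; rewrite !inE => /lt_le_trans/(_ zD).
  rewrite ltr_pM2r ?invr_gt0// ltr_nat; apply: contraTT; rewrite -!leqNgt => ai.
  by rewrite -(nth_index i0 (mem_order ps i)) D// index_order_lt.
Qed.

(** The distance condition makes the two positions different; the shift of the
    argument by [1/n] absorbs the rounding of [y] to a position. *)
Lemma adj_vertex_at (x y : R) : 0 <= x < 1 -> 0 <= y < 1 ->
  1 <= `|x - y| * n%:R ->
  Fminus (degree_distribution R G) (1 - y + n%:R^-1) <= x ->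
  adj (vertex_at s x) (vertex_at s y).
Proof.
move=> x01 y01 xy; rewrite Fminus_vertex_at// /vertex_at.
have n0 : 0 < n%:R :> R by rewrite ltr0n order_graph_gt0.
have [an /andP[ax xa]] := truncn_order x01.
have [bn /andP[by_ yb]] := truncn_order y01.
set i0 := Ordinal _; set a := Num.truncn _ in an ax xa *.
set b := Num.truncn _ in bn by_ yb *.
rewrite ler_pdivlMr// mulrDl mulVf ?gt_eqF// mulrBl mul1r => h.
have [_ /(_ i0 a b an bn)[_ + _]] := sG; apply.
  apply: contraTneq xy => ab; rewrite -ltNge -[ltLHS]ger0_norm ?mulr_ge0//.
  rewrite normrM normr_id -normrM.
  rewrite mulrBl ltr_norml; move: ax xa; rewrite ab -!natr1; lra.
rewrite -(ler_nat R) natrD; move: by_ yb; rewrite -natr1; lra.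
Qed.

(** Here the shift absorbs the missing loop: the vertex over [x] may have one
    neighbour less than its place in the order suggests. *)
Lemma not_adj_vertex_at (x y : R) : 0 <= x < 1 -> 0 <= y < 1 ->
  x < Fminus (degree_distribution R G) (1 - y - n%:R^-1) ->
  ~~ adj (vertex_at s x) (vertex_at s y).
Proof.
move=> x01 y01; rewrite ltNge Fminus_vertex_at// /vertex_at; apply: contra.
have n0 : 0 < n%:R :> R by rewrite ltr0n order_graph_gt0.
have [an /andP[ax xa]] := truncn_order x01.
have [bn /andP[by_ yb]] := truncn_order y01.
set i0 := Ordinal _; set a := Num.truncn _ in an ax xa *.
set b := Num.truncn _ in bn by_ yb *.
have [_ /(_ i0 a b an bn)[_ _]] := sG => /[apply].
rewrite ler_pdivlMr// !mulrBl mulVf ?gt_eqF// mul1r -(ler_nat R) -natr1 natrD.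
move: by_ yb; rewrite -natr1; lra.
Qed.

Lemma deg_vertex_at_le (x y : R) : 0 <= x <= y -> y < 1 ->
  (deg (vertex_at s x) <= deg (vertex_at s y))%N.
Proof.
move=> /andP[x0 xy] y1.
have /truncn_order[bn _] : 0 <= y < 1 by rewrite (le_trans x0 xy).
have /truncn_order[an _] : 0 <= x < 1 by rewrite x0 (le_lt_trans xy).
have [_ /(_ (Ordinal (order_graph_gt0 G)) _ _ an bn)[+ _ _]] := sG; apply.
by apply: le_truncn; rewrite ler_wpM2r.
Qed.

End step_function.

(** * Integrals of bounded functions *)

Section bounded_integrals.
Context d (T : measurableType d) (R : realType) (P : probability T R).

Lemma bounded_integrable (f : T -> R) (M : R) : measurable_fun setT f ->
  (forall x, `|f x| <= M) -> P.-integrable setT (EFin \o f).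
Proof.
move=> mf fM; apply: (@le_integrable _ _ _ _ _ _ _ (EFin \o cst M)) => //.
- exact/measurable_EFinP.
- by move=> x _; rewrite /= lee_fin (le_trans (fM x))// ler_norm.
- exact: finite_measure_integrable_cst.
Qed.

Lemma bounded_convergence (f_ : nat -> T -> R) (f : T -> R) (M : R) :
  (forall n, measurable_fun setT (f_ n)) -> measurable_fun setT f ->
  (forall n x, `|f_ n x| <= M) -> (forall x, `|f x| <= M) ->
  {ae P, forall x, f_ ^~ x @ \oo --> f x} ->
  (fun n => \int[P]_x f_ n x) @ \oo --> \int[P]_x f x.
Proof.
move=> mf_ mf f_M fM ff.
have [|||||_ _ cvf] := @dominated_convergence _ _ _ P setT measurableT
  (fun n => EFin \o f_ n) (EFin \o f) (EFin \o cst M).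
- by move=> n; exact/measurable_EFinP.
- exact/measurable_EFinP.
- by apply: filterS ff => x fx _ /=; apply: cvg_EFin => //; exact: nearW.
- exact: finite_measure_integrable_cst.
- by apply: aeW => x n _ /=; rewrite lee_fin.
apply: fine_cvg; rewrite fineK; first exact: cvf.
exact: integrable_fin_num (bounded_integrable mf fM).
Qed.

(** No measurable structure is put on [I]: measurable fibres are enough. *)
Lemma Rintegral_finite (I : finType) (h : T -> I) (g : I -> R) :
  (forall i, measurable (h @^-1` [set i])) ->
  \int[P]_x g (h x) = \sum_i g i * fine (P (h @^-1` [set i])).
Proof.
move=> mh; rewrite /Rintegral.
have mind i : measurable_fun setT (\1_(h @^-1` [set i]) : T -> R).
  exact: measurable_indic.
have iind i : P.-integrable setT (EFin \o (\1_(h @^-1` [set i]) : T -> R)).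
  apply: (@bounded_integrable _ 1) => // x.
  by rewrite indicE; case: (_ \in _); rewrite ?normr1 ?normr0 ?ler01.
have -> : (fun x => (g (h x))%:E) = (fun x => \sum_(i : I)
    ((g i)%:E * (\1_(h @^-1` [set i]) x)%:E))%E.
  apply/funext => x; rewrite (bigD1 (h x)) //= big1 ?adde0.
    by rewrite indicE mem_set ?mule1.
  by move=> i /eqP ih; rewrite indicE memNset ?mule0// => /esym.
rewrite integral_sum//; last first.
  by move=> i; apply: (@integrableZl _ _ _ P setT measurableT (g i)); exact: iind.
rewrite (eq_bigr (fun i => (g i * fine (P (h @^-1` [set i])))%:E)) ?sumEFin// => i _.
rewrite integralZl//; last exact: iind.
by rewrite integral_indic// setIT EFinM fineK// fin_num_measure.
Qed.

Lemma measurable_fun_finite (I : finType) (h : T -> I) (g : I -> R) :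
  (forall i, measurable (h @^-1` [set i])) -> measurable_fun setT (g \o h).
Proof.
move=> mh _ Y mY; rewrite setTI.
have -> : (g \o h) @^-1` Y = \bigcup_(i in [set i | Y (g i)]) (h @^-1` [set i]).
  apply/seteqP; split => [x Yx|x [i /= Yi hx]]; first by exists (h x).
  by rewrite /= hx.
by apply: fin_bigcup_measurable => //; exact: finite_finset.
Qed.

End bounded_integrals.

(** * Product measures on tuples *)

Section tuple_prob_facts.
Context d (T : measurableType d) (R : realType) (P : probability T R).

Lemma tuple_probS n (A : set (n.+1.-tuple T)) :
  tuple_prob P n.+1 A =
  (P \x tuple_prob P n)%E (@tuple_cons _ T n @^-1` A).
Proof. by []. Qed.

Lemma tuple_prob_tnth n (i : 'I_n) (A : set T) : measurable A ->
  tuple_prob P n ((fun t : n.-tuple T => tnth t i) @^-1` A) = P A.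
Proof.
move=> mA; elim: n i => [[]//|n IH i].
rewrite tuple_probS.
have [j ->|->] := unliftP ord0 i.
  rewrite [X in (_ \x _)%E X](_ : _ =
    setT `*` ((fun t : n.-tuple T => tnth t j) @^-1` A)); last first.
    by apply/seteqP; split => -[x t] /=; rewrite tnthS //= => -[].
  rewrite product_measure1E//; last first.
    by rewrite -[X in measurable X]setTI; exact: measurable_tnth.
  by rewrite [X in (X * _)%E]probability_setT mul1e; exact: IH.
rewrite [X in (_ \x _)%E X](_ : _ = A `*` setT); last first.
  by apply/seteqP; split => -[x t] /=; rewrite tnth0 //= => -[].
by rewrite product_measure1E// [X in (_ * X)%E]probability_setT mule1.
Qed.

Lemma measurable_tnth2 n (i j : 'I_n) :
  measurable_fun setT (fun t : n.-tuple T => (tnth t i, tnth t j)).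
Proof. by apply: measurable_fun_pair; exact: measurable_tnth. Qed.

(** Two distinct coordinates are independent with law [P]. Only increasing pairs
    of indices occur, because each edge is represented by its increasing pair. *)
Lemma tuple_prob_tnth2 n (i j : 'I_n) (N : set (T * T)) : measurable N -> (i < j)%N ->
  tuple_prob P n ((fun t : n.-tuple T => (tnth t i, tnth t j)) @^-1` N) = (P \x P)%E N.
Proof.
move=> mN; elim: n i j => [[]//|n IH i j ij].
rewrite tuple_probS.
have [j' jE|jE] := unliftP ord0 j; last by move: ij; rewrite jE.
rewrite {}jE in ij *.
have [i' iE|->] := unliftP ord0 i.
  rewrite iE in ij *.
  rewrite [X in (_ \x _)%E X](_ : _ =
    setT `*` ((fun t : n.-tuple T => (tnth t i', tnth t j')) @^-1` N)); last first.
    by apply/seteqP; split => -[x t] /=; rewrite !tnthS //= => -[].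
  rewrite product_measure1E//; last first.
    by rewrite -[X in measurable X]setTI; exact: measurable_tnth2.
  by rewrite [X in (X * _)%E]probability_setT mul1e; exact: IH.
rewrite /= /product_measure1; apply: eq_integral => x _ /=.
rewrite -(tuple_prob_tnth j' (measurable_xsection x mN)); congr (tuple_prob P n _).
apply/seteqP; split => t /=; rewrite /xsection /= !inE /= tnthS tnth0 //.
Qed.

Lemma product_null (N : set (T * T)) (C : set T) : measurable N ->
  P.-negligible C -> (forall x, ~ C x -> P (xsection N x) = 0%E) ->
  (P \x P)%E N = 0%E.
Proof.
move=> mN C0 NC; rewrite /= /product_measure1.
rewrite (@ae_eq_integral _ _ _ P setT (cst 0%E)) ?integral0//.
  exact: measurable_fun_xsection.
apply: negligibleS C0 => x /= xN; apply: contrapT => Cx; apply: xN => _.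
exact: NC.
Qed.

(** If all fibres of [h] have the same mass, then applying [h] to independent
    coordinates gives the uniform law on tuples; this turns integrals over the
    cube into averages over maps of vertices. *)
Lemma tuple_prob_map n (I : finType) (h : T -> I) (m : R) :
  (forall i, measurable (h @^-1` [set i])) ->
  (forall i, P (h @^-1` [set i]) = m%:E) ->
  forall u : n.-tuple I,
    measurable ((@map_tuple n _ _ h) @^-1` [set u]) /\
    tuple_prob P n ((@map_tuple n _ _ h) @^-1` [set u]) = (m ^+ n)%:E.
Proof.
move=> mh Ph.
have mmap k (u : k.-tuple I) : measurable ((@map_tuple k _ _ h) @^-1` [set u]).
  rewrite (_ : _ @^-1` _ = \bigcap_(i in [set: 'I_k])
      ((fun t : k.-tuple T => tnth t i) @^-1` (h @^-1` [set tnth u i]))).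
    apply: fin_bigcap_measurable => [|i _]; first exact: finite_finset.
    by rewrite -[X in measurable X]setTI; exact: measurable_tnth.
  apply/seteqP; split => [t tu i _|t tu]; first by rewrite /= -tu tnth_map.
  by apply: eq_from_tnth => i; rewrite tnth_map; exact: tu.
move=> u; split => //.
elim: n u => [|n IH] u.
  by rewrite /= diracE expr0 mem_set// [u]tuple0; exact: val_inj.
rewrite tuple_probS.
rewrite [X in (_ \x _)%E X](_ : _ = (h @^-1` [set thead u]) `*`
   ((@map_tuple n _ _ h) @^-1` [set behead_tuple u])); last first.
  apply/seteqP; split => -[x t] /=.
    by move=> <-; split; [|apply: val_inj].
  move=> [hx /(congr1 val)/= ht]; apply: val_inj; rewrite [u]tuple_eta /= -hx.
  by rewrite -ht.
rewrite product_measure1E//; last exact: (mmap n).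
by rewrite [X in (X * _)%E]Ph [X in (_ * X)%E]IH exprS.
Qed.

Lemma integral_tuple_prob_map n (I : finType) (h : T -> I) (m : R)
    (g : n.-tuple I -> R) :
  (forall i, measurable (h @^-1` [set i])) ->
  (forall i, P (h @^-1` [set i]) = m%:E) ->
  \int[tuple_prob P n]_t g (map_tuple h t) = m ^+ n * \sum_u g u.
Proof.
move=> mh Ph; have mapP := @tuple_prob_map n _ _ _ mh Ph.
rewrite Rintegral_finite; last by move=> u; have [] := mapP u.
rewrite mulr_sumr; apply: eq_bigr => u _; rewrite mulrC.
by have [_ ->] := mapP u.
Qed.

End tuple_prob_facts.

(** * The uniform law and the law of the degree function *)

Notation unif R := (uniform_prob (@ltr01 R)).

Section uniform_facts.
Context (R : realType).

Lemma unif_itv (a b : R) : 0 <= a -> a <= b -> b <= 1 ->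
  unif R `[a, b[%classic = (b - a)%:E.
Proof.
move=> a0 ab b1.
rewrite /uniform_prob (eq_integral (cst 1%E)); last first.
  move=> x; rewrite inE/= in_itv/= => /andP[ax xb].
  by rewrite /uniform_pdf (le_trans a0 ax) (ltW (lt_le_trans xb b1)) subr0 invr1.
rewrite integral_cst//= mul1e lebesgue_measure_itv/= lte_fin.
by case: ltP => // ba; rewrite (@le_anti _ _ a b) ?ab// subrr.
Qed.

Lemma unif_countable (C : set R) : countable C -> (unif R).-negligible C.
Proof.
move=> cC; have mC : measurable C by apply: countable_measurable.
apply/negligibleP => //.
have /null_content_dominatesP := dominates_uniform_prob (@ltr01 R); apply => //.
exact: countable_lebesgue_measure0.
Qed.

Lemma unif_mem01 : {ae unif R, forall x, 0 <= x < 1}.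
Proof.
exists (~` `[0, 1[%classic); split.
- exact: measurableC.
- have -> : unif R (~` `[0, 1[%classic) = (1 - unif R `[0%R, 1%R[%classic)%E.
    exact: probability_setC.
  by rewrite unif_itv// subr0 subee.
- by move=> x /= x01; rewrite in_itv.
Qed.

(** The uniform law ignores what happens outside [[0,1)]. *)
Lemma unif_ae_eq (A B : set R) : measurable A -> measurable B ->
  A `&` `[0, 1[%classic = B `&` `[0, 1[%classic -> unif R A = unif R B.
Proof.
move=> mA mB AB.
have restr C : measurable C -> unif R C = unif R (C `&` `[0%R, 1%R[%classic).
  move=> mC.
  have [N [mN N0 subN]] := unif_mem01.
  have -> : unif R C = (unif R (C `\` `[0%R, 1%R[%classic) +
      unif R (C `&` `[0%R, 1%R[%classic))%E by exact: measureDI.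
  rewrite [X in (X + _)%E](_ : _ = 0%E) ?add0e//.
  apply: (subset_measure0 _ mN) => //; first exact: measurableD.
  by move=> x [_ /=]; rewrite in_itv/= => x01; exact: subN.
by rewrite restr// AB -restr.
Qed.

Lemma continuous01_bounded (f : R -> R) : {within `[0, 1], continuous f} ->
  exists M : R, forall x, 0 <= x <= 1 -> `|f x| <= M.
Proof.
move=> cf; have [c c01 fc] := EVT_max ler01 cf.
have [d d01 fd] := EVT_min ler01 cf.
exists (`|f c| + `|f d|) => x x01; rewrite ler_norml.
have := fc x; have := fd x; rewrite !in_itv/= => /(_ x01) dx /(_ x01) xc.
have := ler_norm (f c); have := lerNnormlW (lexx `|f d|).
have := normr_ge0 (f c); have := normr_ge0 (f d); lra.
Qed.

(** Change of variables. Continuity on [[0,1]] alone says nothing about [f]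
    elsewhere, so [f] is replaced by its extension by [0], which is measurable
    and agrees with [f] on the range of [q]. *)
Lemma Rintegral_image (mu : prob01 R) (q f : R -> R) :
  measurable_fun setT q -> (forall x, 0 <= q x <= 1) ->
  (forall A, measurable A -> mu A = unif R (q @^-1` A)) ->
  {within `[0, 1], continuous f} ->
  \int[mu]_(x in `[0, 1]) f x = \int[unif R]_x f (q x).
Proof.
move=> mq q01 muq cf.
have [M fM] := continuous01_bounded cf.
have mf : measurable_fun (`[0, 1]%classic : set R) f.
  exact: subspace_continuous_measurable_fun.
pose f' := f \_ (`[0, 1]%classic : set R).
have mf' : measurable_fun setT f'.
  exact: (@measurable_restrictT _ _ (measurableTypeR R) (measurableTypeR R) _ f
    (measurable_itv _)).1 mf.
have f'M x : `|f' x| <= M.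
  rewrite /f' patchE; case: ifPn => [|_]; first by rewrite inE/= in_itv/= => /fM.
  by rewrite normr0 (le_trans _ (fM 0 _))// lexx ler01.
have f'q x : f' (q x) = f (q x) by rewrite /f' patchE mem_set//= in_itv/=.
pose X : {RV unif R >-> measurableTypeR R} := 
  @mfun_Sub _ _ (measurableTypeR R) (measurableTypeR R) q (mem_set mq).
rewrite Rintegral_mkcond /Rintegral; congr fine.
rewrite (@eq_measure_integral _ _ _ setT (distribution (unif R) X)); last first.
  by move=> A mA _; exact: muq.
rewrite integral_distribution/=.
- by apply: eq_integral => x _; rewrite /= -f'q.
- exact/measurable_EFinP.
- apply: (@bounded_integrable _ (measurableTypeR R) _ (unif R) (f' \o q) M) => //.
  + exact: measurableT_comp.
  + by move=> x; exact: f'M.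
Qed.

End uniform_facts.

Section step_law.
Context (R : realType) (G : graph) (s : seq (vertex G)).
Hypothesis ps : perm_eq s (enum (vertex G)).
Local Notation n := (order_graph G).

Lemma measurable_vertex_at (i : vertex G) :
  measurable (@vertex_at R G s @^-1` [set i]).
Proof.
set i0 := Ordinal (order_graph_gt0 G).
pose T (x : R) : R := (Num.truncn (x * n%:R))%:R.
have mT : measurable_fun setT T.
  apply: nondecreasing_measurable => // x y xy.
  by rewrite /T ler_nat; apply: le_truncn; rewrite ler_wpM2r.
rewrite (_ : _ @^-1` _ = \bigcup_(k in [set k | nth i0 s k = i]) (T @^-1` [set k%:R])).
  by apply: bigcup_measurable => k _; rewrite -[X in measurable X]setTI; exact: mT.
apply/seteqP; split => [x <-|x [k /= <- /eqP]]; first by exists (Num.truncn (x * n%:R)).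
by rewrite eqr_nat /vertex_at => /eqP ->.
Qed.

(** On [[0,1)], the vertex in position [k] lies over [[k/n, (k+1)/n)]. *)
Lemma unif_vertex_at (i : vertex G) :
  unif R (vertex_at s @^-1` [set i]) = (n%:R^-1)%:E.
Proof.
have n0 : 0 < n%:R :> R by rewrite ltr0n order_graph_gt0.
set i0 := Ordinal (order_graph_gt0 G).
pose k := index i s; have kn : (k < n)%N by exact: index_order_lt.
rewrite (@unif_ae_eq _ _ `[k%:R / n%:R, k.+1%:R / n%:R[%classic).
- rewrite unif_itv ?divr_ge0//.
  + by rewrite -mulrBl -natrB// subSnn mul1r.
  + by rewrite ler_pM2r ?invr_gt0// ler_nat.
  + by rewrite ler_pdivrMr// mul1r ler_nat.
- exact: measurable_vertex_at.
- exact: measurable_itv.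
apply/seteqP; split => x /= [+ x01]; rewrite in_itv/=.
- move=> xi; split => //; have [an] := truncn_order G (x01 : 0 <= x < 1).
  rewrite ler_pdivrMr// ltr_pdivlMr// /k -xi /vertex_at index_uniq ?size_order//.
  exact: uniq_order.
- rewrite ler_pdivrMr// ltr_pdivlMr// => /truncn_def kE.
  by rewrite /vertex_at kE nth_index// mem_order.
Qed.

Definition degree_at (x : R) : R := (deg (vertex_at s x))%:R / n%:R.

Lemma degree_at01 x : 0 <= degree_at x <= 1.
Proof.
rewrite divr_ge0//= ler_pdivrMr ?ltr0n ?order_graph_gt0// mul1r ler_nat.
by rewrite -[leqRHS]card_ord max_card.
Qed.

Lemma measurable_degree_at : measurable_fun setT degree_at.
Proof.
apply: (@measurable_fun_finite _ _ _ _ _ (fun i : vertex G => (deg i)%:R / n%:R)).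
exact: measurable_vertex_at.
Qed.

Lemma integral_vertex_at (g : vertex G -> R) :
  \int[unif R]_x g (vertex_at s x) = n%:R^-1 * \sum_i g i.
Proof.
rewrite Rintegral_finite; last exact: measurable_vertex_at.
rewrite mulr_sumr; apply: eq_bigr => i _.
by rewrite mulrC; congr (_ * _); rewrite [X in fine X]unif_vertex_at.
Qed.

(** The degree function is a quantile function of the degree distribution. *)
Lemma degree_distribution_law (A : set R) : measurable A ->
  degree_distribution R G A = unif R (degree_at @^-1` A).
Proof.
move=> mA; have mqA : measurable (degree_at @^-1` A).
  by rewrite -[X in measurable X]setTI; exact: measurable_degree_at.
rewrite -[RHS]fineK ?fin_num_measure//.
have <- : \int[unif R]_x \1_A (degree_at x) = fine (unif R (degree_at @^-1` A)).
  rewrite /Rintegral; congr fine.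
  transitivity (\int[unif R]_x (\1_(degree_at @^-1` A) x)%:E)%E; first by [].
  by rewrite integral_indic// setIT.
rewrite (integral_vertex_at (fun i => \1_A ((deg i)%:R / n%:R))).
rewrite /= /degree_measure EFinM; congr (_ * _)%E.
by rewrite -sumEFin; apply: eq_bigr => i _; rewrite diracE indicE.
Qed.

Lemma integral_degree_distribution (f : R -> R) : {within `[0, 1], continuous f} ->
  \int[degree_distribution R G]_(x in `[0, 1]) f x = \int[unif R]_x f (degree_at x).
Proof.
apply: Rintegral_image.
- exact: measurable_degree_at.
- exact: degree_at01.
- exact: degree_distribution_law.
Qed.

End step_law.

(** * Distribution functions under weak convergence *)

Section Fminus_facts.
Context (R : realType).
Implicit Types (m : prob01 R) (z : R).

Lemma Fminus_le1 m z : Fminus m z <= 1.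
Proof.
rewrite -[leRHS]/(fine 1%E) /Fminus fine_le ?fin_num_measure//.
exact: probability_le1.
Qed.

Lemma Fminus0 m : Fminus m 0 = 0.
Proof. by rewrite /Fminus set_itvco0 measure0. Qed.

Lemma Fminus_integral m z :
  Fminus m z = \int[m]_(x in `[0, 1]) \1_(`[0, z[%classic : set R) x.
Proof.
rewrite /Rintegral integral_indic// /Fminus; congr fine.
have m01C : m (~` `[0, 1]%classic : set R) = 0%E.
  by rewrite probability_setC// prob01_support subee.
pose I b : set (measurableTypeR R) := `[0, b[%classic.
pose J : set (measurableTypeR R) := `[0, 1]%classic.
have -> : m (I z) = (m (I z `\` J) + m (I z `&` J))%E.
  by apply: measureDI; exact: measurable_itv.
rewrite [X in (X + _)%E](_ : _ = 0%E) ?add0e//.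
apply: (@subset_measure0 _ _ _ m _ (~` J)) => //.
- by apply: measurableD; exact: measurable_itv.
- by apply: measurableC; exact: measurable_itv.
Qed.

(** Continuous, equal to [1] before [a] and to [0] after [b]. *)
Definition ramp (a b x : R) : R := Num.min 1 (Num.max 0 ((b - x) / (b - a))).

Lemma ramp_itv a b x : 0 <= ramp a b x <= 1.
Proof. by rewrite /ramp le_min ler01 ge_min lexx le_max lexx. Qed.

Lemma continuous_ramp a b : continuous (ramp a b).
Proof.
move=> x; apply: (@continuous_min R R (cst 1)
  (fun x => Num.max 0 ((b - x) / (b - a)))); first exact: cvg_cst.
apply: (@continuous_max R R (cst 0) (fun x => (b - x) / (b - a))).
  exact: cvg_cst.
by apply: cvgM; [apply: cvgB; [exact: cvg_cst|exact: cvg_id]|exact: cvg_cst].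
Qed.

Lemma ramp_integral_itv m a b : a < b ->
  Fminus m a <= \int[m]_(x in `[0, 1]) ramp a b x <= Fminus m b.
Proof.
move=> ab; rewrite !Fminus_integral.
have ramp_int : m.-integrable `[0, 1] (EFin \o ramp a b).
  apply: (@integrableS _ _ _ _ setT) => //.
  apply: (@bounded_integrable _ (measurableTypeR R) _ m _ 1).
    have mr : measurable_fun setT (ramp a b).
      by apply: continuous_measurable_fun; exact: continuous_ramp.
    exact: mr.
  by move=> x; have /andP[r0 r1] := ramp_itv a b x; rewrite ger0_norm.
have ind_int c : m.-integrable `[0, 1] (EFin \o \1_(`[0, c[%classic : set R)).
  apply: (@integrableS _ _ _ _ setT) => //.
  apply: (@bounded_integrable _ (measurableTypeR R) _ m _ 1).
    exact: measurable_indic.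
  by move=> x; rewrite indicE; case: (_ \in _); rewrite ?normr1 ?normr0 ?ler01.
have ba : 0 < b - a by rewrite subr_gt0.
apply/andP; split; apply: le_Rintegral => // x; rewrite /= in_itv/= indicE => /andP[x0 _].
- have [|_] := boolP (x \in _); last by case/andP: (ramp_itv a b x).
  rewrite inE/= in_itv/= => /andP[_ xa].
  rewrite /ramp le_min lexx le_max ler_pdivlMr// mul1r lerB ?orbT//; exact: ltW.
- have [_|] := boolP (x \in _); first by case/andP: (ramp_itv a b x).
  rewrite notin_setE/= in_itv/= x0/= => /negP; rewrite -leNgt => bx.
  by rewrite /ramp ge_min ge_max lexx /= ler_pdivrMr// mul0r subr_le0 bx orbT.
Qed.

Lemma Fminus_left_continuous m z x : x < Fminus m z ->
  exists2 e, 0 < e & x < Fminus m (z - e).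
Proof.
move=> xz; pose F k : set (measurableTypeR R) := `[0, z - k.+1%:R^-1[%classic.
have cF : m \o F @ \oo --> m (\bigcup_k F k).
  apply: nondecreasing_cvg_mu.
  - by move=> k; exact: measurable_itv.
  - by apply: bigcup_measurable => k _; exact: measurable_itv.
  - move=> i j ij; apply/subsetPset => y; rewrite /F /= !in_itv/= => /andP[-> /=].
    move=> /lt_le_trans; apply; rewrite lerD2l lerN2 lef_pV2 ?posrE//.
    by rewrite ler_nat.
have UF : \bigcup_k F k = `[0, z[%classic.
  apply/seteqP; split => y.
    move=> [k _]; rewrite /F /= !in_itv/= => /andP[-> /= /lt_le_trans]; apply.
    by rewrite gerBl invr_ge0.
  rewrite /= in_itv/= => /andP[y0 yz].
  have yz0 : 0 < z - y by rewrite subr_gt0.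
  have [k _ /(_ k (leqnn k)) /= kP] := near_infty_natSinv_lt (PosNum yz0).
  by exists k => //; rewrite /F /= in_itv/= y0/= ltrBrDr -ltrBrDl.
rewrite UF in cF.
have cF' : (fun k => Fminus m (z - k.+1%:R^-1)) @ \oo --> Fminus m z.
  by apply: fine_cvg; rewrite fineK ?fin_num_measure.
have [k _ /(_ k (leqnn k)) /= kP] := cvgr_gt _ cF' _ xz.
by exists k.+1%:R^-1.
Qed.

(** Weak convergence controls distribution functions only at continuity points
    of the limit; allowing the argument to move from [a] to [b] gives bounds
    which hold everywhere. *)
Lemma weak_Fminus (nu : nat -> prob01 R) m : weakly_converges nu m ->
  forall a b e, a < b -> 0 < e ->
  \forall n \near \oo,
    Fminus (nu n) a <= Fminus m b + e /\ Fminus m a - e <= Fminus (nu n) b.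
Proof.
move=> num a b e ab e0.
have cr : {within `[0, 1], continuous (ramp a b)}.
  by apply: continuous_subspaceT; exact: continuous_ramp.
have /cvgrPdist_le/(_ e e0) := num _ cr.
apply: filterS => n; rewrite ler_norml => ne.
have := ramp_integral_itv (nu n) ab; have := ramp_integral_itv m ab; lra.
Qed.

End Fminus_facts.

(** * Homomorphism densities as integrals over the cube *)

Definition edge_product (R : realType) (F : graph) (T : Type) (W : T * T -> R)
    (u : (order_graph F).-tuple T) : R :=
  \prod_(e : vertex F * vertex F | ((e.1 < e.2)%N) && adj e.1 e.2)
      W (tnth u e.1, tnth u e.2).

(** Real-valued, so that [edge_product] applies to graphs and graphons alike. *)
Definition adjacency (R : realType) (G : graph) (e : vertex G * vertex G) : R :=
  (adj e.1 e.2)%:R.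

(** The homomorphism condition concerns ordered pairs, whereas each edge occurs
    once in the product; symmetry of adjacency makes up the difference. *)
Lemma is_hom_edge_product (R : realType) (F G : graph)
    (f : {ffun vertex F -> vertex G}) :
  edge_product (@adjacency R G) [tuple f i | i < order_graph F] = (is_hom f)%:R.
Proof.
rewrite /edge_product; case: (boolP (is_hom f)) => [/forallP hom|].
  rewrite big1 // => -[i j] /= /andP[_ ij]; rewrite /adjacency /= !tnth_mktuple.
  by have /forallP/(_ j)/implyP -> := hom i.
move=> /forallPn[i /forallPn[j]]; rewrite negb_imply => /andP[ij nij].
wlog lij : i j ij nij / (i < j)%N => [wl|].
  have [| |/ord_inj ji] := ltngtP i j; first exact: wl.
    by apply: wl; rewrite adj_sym.
  by move: ij; rewrite ji adj_irrefl.
rewrite (bigD1 (i, j)) /= ?lij//= /adjacency /= !tnth_mktuple (negbTE nij).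
by rewrite mul0r.
Qed.

(** Independent uniform points lie over independent uniform vertices, so the
    density is the expectation of the indicator of a homomorphism. *)
Lemma hom_density_integral (R : realType) (F G : graph) (s : seq (vertex G)) :
  perm_eq s (enum (vertex G)) ->
  hom_density R F G =
  \int[cube_measure R (order_graph F)]_t
    edge_product (@adjacency R G) (map_tuple (vertex_at s) t).
Proof.
move=> ps; rewrite /cube_measure.
rewrite (@integral_tuple_prob_map _ (measurableTypeR R) R _ _ _ (@vertex_at R G s)
  ((order_graph G)%:R^-1)).
- rewrite /hom_density card_ffun !card_ord natrX mulrC exprVn; congr (_ * _).
  pose to (f : {ffun vertex F -> vertex G}) := [tuple f i | i < order_graph F].
  rewrite (reindex to) /=; last first.
    exists (fun u => [ffun i => tnth u i]) => [f _|u _].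
      by apply/ffunP => i; rewrite ffunE tnth_mktuple.
    by apply: eq_from_tnth => i; rewrite tnth_mktuple ffunE.
  under eq_bigr do rewrite is_hom_edge_product.
  rewrite -natr_sum -sum1_card [in LHS]big_mkcond /=; congr (_%:R).
- exact: measurable_vertex_at.
- exact: unif_vertex_at.
Qed.

(** * Pointwise limit of adjacency and symmetry of the limit *)

Section adjacency_limit.
Context (R : realType) (G : nat -> graph) (s : forall n, seq (vertex (G n))).
Hypothesis sG : forall n, nested_order (s n).
Hypothesis G_order : (fun n => order_graph (G n)) @ \oo --> \oo.
Context (mu : prob01 R).
Hypothesis weak_mu : weakly_converges (fun n => degree_distribution R (G n)) mu.

Lemma order_inv_le (c : R) : 0 < c ->
  \forall n \near \oo, (order_graph (G n))%:R^-1 <= c.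
Proof.
move=> c0; move/cvgnyPge: G_order => /(_ (Num.truncn c^-1).+1).
apply: filterS => n cn.
have n0 : 0 < (order_graph (G n))%:R :> R by rewrite ltr0n order_graph_gt0.
rewrite -[leRHS]invrK lef_pV2 ?posrE ?invr_gt0//.
have cV0 : 0 <= c^-1 by rewrite invr_ge0 ltW.
have /andP[_ /ltW/le_trans] := truncn_itv cV0; apply.
by rewrite ler_nat.
Qed.

(** If [F_mu] is still below [x] a little to the right of [1 - y], this remains
    true for the degree distributions of large graphs. *)
Lemma near_adj (x y e : R) : 0 <= x < 1 -> 0 <= y < 1 -> x != y -> 0 < e ->
  Fminus mu (1 - y + e) < x ->
  \forall n \near \oo, adj (vertex_at (s n) x) (vertex_at (s n) y).
Proof.
move=> x01 y01 xy e0 Fx.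
have xy0 : 0 < `|x - y| by rewrite normr_gt0 subr_eq0.
have zz : 1 - y + e / 2 < 1 - y + e by lra.
have xF0 : 0 < x - Fminus mu (1 - y + e) by rewrite subr_gt0.
near=> n.
have n0 : 0 < (order_graph (G n))%:R :> R by rewrite ltr0n order_graph_gt0.
apply: adj_vertex_at => //.
  rewrite -ler_pdivrMr// mul1r; near: n; exact: order_inv_le.
apply: (@le_trans _ _ (Fminus (degree_distribution R (G n)) (1 - y + e / 2))).
  apply: Fminus_nondecreasing; rewrite lerD2l; near: n; apply: order_inv_le; lra.
have : Fminus (degree_distribution R (G n)) (1 - y + e / 2) <=
    Fminus mu (1 - y + e) + (x - Fminus mu (1 - y + e)).
  by near: n; have := weak_Fminus weak_mu zz xF0; apply: filterS => n [].
by rewrite subrKC.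
Unshelve. all: by end_near. Qed.

(** Left continuity of [F_mu] provides the room needed to the left of [1 - y]. *)
Lemma near_not_adj (x y : R) : 0 <= x < 1 -> 0 <= y < 1 ->
  x < Fminus mu (1 - y) ->
  \forall n \near \oo, ~~ adj (vertex_at (s n) x) (vertex_at (s n) y).
Proof.
move=> x01 y01 /Fminus_left_continuous[e e0 Fx].
have zz : 1 - y - e < 1 - y - e / 2 by lra.
have xF0 : 0 < (Fminus mu (1 - y - e) - x) / 2 by lra.
near=> n.
apply: not_adj_vertex_at => //.
apply: (@lt_le_trans _ _ (Fminus (degree_distribution R (G n)) (1 - y - e / 2))); last first.
  apply: Fminus_nondecreasing; rewrite lerD2l lerN2; near: n; apply: order_inv_le; lra.
have : Fminus mu (1 - y - e) - (Fminus mu (1 - y - e) - x) / 2 <=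
    Fminus (degree_distribution R (G n)) (1 - y - e / 2).
  by near: n; have := weak_Fminus weak_mu zz xF0; apply: filterS => n [].
lra.
Unshelve. all: by end_near. Qed.

(** The two sides [x = 1] and [y = 1] of the square belong to [S_mu]. Elsewhere,
    if [(x, y)] is in [S_mu] and [(y, x)] is not, then moving both points by a
    small [(d, d)] makes the strict inequalities of [near_adj] and
    [near_not_adj] hold at [(x + d, y + d)] and [(y + d, x + d)], which
    contradicts the symmetry of adjacency in a large graph. *)
Lemma S_mu_sym (x y : R) : S_mu mu (x, y) -> S_mu mu (y, x).
Proof.
move=> [[/= /andP[x0 x1] /andP[y0 y1]] Fx].
split=> /=; first by split; apply/andP.
move: x1; rewrite le_eqVlt => /predU1P[->|x1].
  by rewrite subrr Fminus0.
move: y1; rewrite le_eqVlt => /predU1P[->|y1].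
  exact: Fminus_le1.
rewrite leNgt; apply/negP => yF.
have xy : x != y by apply: contraTneq yF => xy; rewrite -leNgt; move: Fx; rewrite /= xy.
have [e e0 yFe] := Fminus_left_continuous yF.
(* The displacement is [m / 2]; it must keep both points in the square and
   respect the strict inequality [yFe] and the margin [e]. *)
pose m := Num.min (Num.min e (Fminus mu (1 - x - e) - y)) (Num.min (1 - x) (1 - y)).
have m0 : 0 < m by rewrite /m !lt_min !subr_gt0 e0 yFe x1 y1.
have : [/\ m <= e, m <= Fminus mu (1 - x - e) - y, m <= 1 - x & m <= 1 - y].
  by rewrite /m; split; rewrite !ge_min lexx ?orbT.
pose d := m / 2.
have -> : m = 2 * d by rewrite /d; lra.
have {m0} d0 : 0 < d by rewrite /d; lra.
move=> [de dF dx dy].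
have nadj : \forall n \near \oo, ~~ adj (vertex_at (s n) (y + d)) (vertex_at (s n) (x + d)).
  apply: near_not_adj; [lra|lra|].
  apply: (@lt_le_trans _ _ (Fminus mu (1 - x - e))); first lra.
  by apply: Fminus_nondecreasing; lra.
have yadj : \forall n \near \oo, adj (vertex_at (s n) (x + d)) (vertex_at (s n) (y + d)).
  apply: (@near_adj _ _ (d / 2)); [lra|lra| |lra|].
    by rewrite (inj_eq (addIr _)).
  apply: (@le_lt_trans _ _ (Fminus mu (1 - y))); last lra.
  by apply: Fminus_nondecreasing; lra.
have [n _ /(_ n (leqnn n))[]] := filterI nadj yadj.
by rewrite adj_sym => /negP.
Qed.

Lemma P_s_limit : P_s mu.
Proof. by apply/seteqP; split => -[x y]; exact: S_mu_sym. Qed.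

End adjacency_limit.

(** * Limits of homomorphism densities *)

Section density_limit.
Context (R : realType) (mu : prob01 R).

(** The points [(x, y)] at which the limit of adjacency is not determined:
    [x] lies between the left and right limits of [F_mu] at [1 - y]. *)
Definition ambiguous : set (R * R) :=
  [set p | forall k : nat,
    Fminus mu (1 - p.2) <= p.1 <= Fminus mu (1 - p.2 + k.+1%:R^-1)].

Lemma measurable_Fminus (c : R) :
  measurable_fun setT (fun p : R * R => Fminus mu (1 - p.2 + c)).
Proof.
apply: (@measurableT_comp _ _ _ _ _ _ (Fminus mu)).
  exact: (nondecreasing_measurable _ (Fminus_nondecreasing mu)).
apply: measurable_funD => //.
by apply: measurable_funB => //; exact: measurable_snd.
Qed.

Lemma measurable_ambiguous : measurable ambiguous.
Proof.
have -> : ambiguous = \bigcap_(k : nat)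
    ([set p : R * R | Fminus mu (1 - p.2 + 0) <= p.1] `&`
     [set p : R * R | p.1 <= Fminus mu (1 - p.2 + k.+1%:R^-1)]).
  apply/seteqP; split => [p pk k _|p pk k] /=.
    by have /andP[] := pk k; rewrite addr0.
  by have := pk k I; rewrite /= addr0 => -[-> ->].
apply: bigcapT_measurable => k; apply: measurableI.
- have := measurable_fun_ler (measurable_Fminus 0) (@measurable_fst _ _ R R).
  by move=> /(_ measurableT [set true] I); rewrite setTI.
- have := measurable_fun_ler (@measurable_fst _ _ R R) (measurable_Fminus k.+1%:R^-1).
  by move=> /(_ measurableT [set true] I); rewrite setTI.
Qed.

(** Two such [y] would make [F_mu] constant with value [x] on an interval, hence
    at a rational point. *)
Lemma ambiguous_unique (x y1 y2 : R) :
  ~ range (fun q : rat => Fminus mu (ratr q)) x ->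
  ambiguous (x, y1) -> ambiguous (x, y2) -> y1 = y2.
Proof.
move=> xQ.
wlog y12 : y1 y2 / y1 < y2 => [wl a1 a2|a1 a2].
  have [y12|y21|//] := ltgtP y1 y2; first exact: wl.
  by apply/esym; exact: wl.
have [q] : exists q : rat, ratr q \in `]1 - y2, 1 - y1[.
  by apply: rat_in_itvoo; lra.
rewrite in_itv/= => /andP[q2 q1].
have q20 : 0 < ratr q - (1 - y2) by rewrite subr_gt0.
have [k _ /(_ k (leqnn k)) /= kP] := near_infty_natSinv_lt (PosNum q20).
exfalso; apply: xQ; exists q => //; apply: le_anti; apply/andP; split.
  have /andP[/= + _] := a1 0%N; apply: le_trans.
  by apply: Fminus_nondecreasing; exact: ltW.
have /andP[/= _] := a2 k => /le_trans; apply.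
by apply: Fminus_nondecreasing; rewrite -lerBrDl ltW.
Qed.

Definition exceptional : set (R * R) := ambiguous `|` [set p | p.1 = p.2].

Lemma measurable_exceptional : measurable exceptional.
Proof.
apply: measurableU; first exact: measurable_ambiguous.
have := measurable_fun_eqr (@measurable_fst _ _ R R) (@measurable_snd _ _ R R).
move=> /(_ measurableT [set true] I); rewrite setTI.
by congr measurable; apply/seteqP; split => p /= /eqP.
Qed.

(** Fubini: outside the countable set of values of [F_mu] at rational points,
    the vertical sections have at most two points. *)
Lemma exceptional_null : (unif R \x unif R)%E exceptional = 0%E.
Proof.
apply: (@product_null _ (measurableTypeR R) R (unif R) _
  (range (fun q : rat => Fminus mu (ratr q)))).
- exact: measurable_exceptional.
- by apply: unif_countable; apply: sub_countable (card_image_le _ _) _; exact: countableP.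
- move=> x xQ; apply/negligibleP.
    by apply: measurable_xsection; exact: measurable_exceptional.
  apply: unif_countable.
  have [[y0 a0]|noa] := pselect (exists y, ambiguous (x, y)).
    apply: (@sub_countable _ _ _ [set y0; x]); last exact: finite_set_countable.
    apply: subset_card_le => y; rewrite /xsection /= inE => -[a|/= ->]; last by right.
    by left; apply: ambiguous_unique a a0.
  apply: (@sub_countable _ _ _ [set x]); last exact: finite_set_countable.
  apply: subset_card_le => y; rewrite /xsection /= inE => -[a|/= ->//].
  by case: noa; exists y.
Qed.

Lemma measurable_W_mu : measurable_fun setT (W_mu mu).
Proof. by apply: measurable_indic; exact: measurable_S. Qed.

Context (G : nat -> graph) (s : forall n, seq (vertex (G n))).
Hypothesis sG : forall n, nested_order (s n).
Hypothesis G_order : (fun n => order_graph (G n)) @ \oo --> \oo.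
Hypothesis weak_mu : weakly_converges (fun n => degree_distribution R (G n)) mu.

Lemma near_adj_W_mu (x y : R) : 0 <= x < 1 -> 0 <= y < 1 ->
  ~ exceptional (x, y) ->
  \forall n \near \oo,
    adjacency R (vertex_at (s n) x, vertex_at (s n) y) = W_mu mu (x, y).
Proof.
move=> x01 y01 /not_orP[na /= /eqP xy].
have sq : unit_square (x, y).
  by split=> /=; [case/andP: x01|case/andP: y01] => -> /ltW ->.
have [Fx|xF] := leP (Fminus mu (1 - y)) x; last first.
  have := near_not_adj sG G_order weak_mu x01 y01 xF; apply: filterS => n nadj.
  rewrite /adjacency /= (negbTE nadj) /W_mu indicE memNset// => -[_ /=].
  by rewrite leNgt xF.
have [k xk] : exists k : nat, Fminus mu (1 - y + k.+1%:R^-1) < x.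
  apply: contrapT => /forallNP nk; apply: na => k /=; rewrite Fx /= leNgt.
  exact/negP/nk.
have k0 : 0 < k.+1%:R^-1 :> R by rewrite invr_gt0.
have := near_adj sG G_order weak_mu x01 y01 xy k0 xk; apply: filterS => n nadj.
by rewrite /adjacency /= nadj /W_mu indicE mem_set.
Qed.

Lemma cube_mem01 k :
  {ae cube_measure R k, forall t : k.-tuple (measurableTypeR R), forall i,
     0 <= tnth t i < 1}.
Proof.
apply: filter_forall => i.
have [N [mN N0 subN]] := unif_mem01 R.
exists ((fun t => tnth t i) @^-1` N); split.
- by rewrite -[X in measurable X]setTI; exact: measurable_tnth.
- by rewrite /cube_measure (tuple_prob_tnth _ _ mN).
- by move=> t /= ti; exact: subN.
Qed.

Lemma cube_edges (F : graph) (N : set (R * R)) : measurable N ->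
  (unif R \x unif R)%E N = 0%E ->
  {ae cube_measure R (order_graph F),
    forall t, forall e : vertex F * vertex F, (e.1 < e.2)%N ->
      ~ N (tnth t e.1, tnth t e.2)}.
Proof.
move=> mN N0; apply: filter_forall => e.
have [e12|e12] := boolP (e.1 < e.2)%N; last exact: aeW.
exists ((fun t => (tnth t e.1, tnth t e.2)) @^-1` N); split.
- by rewrite -[X in measurable X]setTI; exact: measurable_tnth2.
- by rewrite /cube_measure tuple_prob_tnth2.
- by move=> t /= nt; apply: contrapT => Nt; apply: nt.
Qed.

Lemma measurable_edge_product (F : graph) (W : R * R -> R) :
  measurable_fun setT W ->
  measurable_fun setT (@edge_product R F (measurableTypeR R) W).
Proof.
move=> mW; rewrite /edge_product.
under eq_fun do rewrite big_mkcond.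
apply: measurable_prod => e _ /=.
case: ((e.1 < e.2)%N && adj e.1 e.2); last exact: measurable_cst.
by apply: (measurableT_comp mW); exact: measurable_tnth2.
Qed.

Lemma edge_product_itv (F : graph) (T : Type) (W : T * T -> R) u :
  (forall p, 0 <= W p <= 1) -> 0 <= @edge_product R F T W u <= 1.
Proof.
move=> W01; apply/andP; split; last by apply: prodr_ile1 => e _; exact: W01.
by apply: prodr_ge0 => e _; case/andP: (W01 (tnth u e.1, tnth u e.2)).
Qed.

Lemma measurable_unit_cube k : measurable (@unit_cube R k).
Proof.
rewrite (_ : @unit_cube R k = \bigcap_(i in [set: 'I_k])
   ((fun t : k.-tuple (measurableTypeR R) => tnth t i) @^-1` `[0, 1]%classic)).
  apply: fin_bigcap_measurable => [|i _]; first exact: finite_finset.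
  by rewrite -[X in measurable X]setTI; exact: measurable_tnth.
apply/seteqP; split => [t t01 i _|t t01 i]; first by rewrite /= in_itv/=.
by have := t01 i I; rewrite /= in_itv/=.
Qed.

(** Almost surely no pair of coordinates is exceptional, and the integrand is
    then eventually constant in [n]; since the integrands are bounded by [1],
    dominated convergence applies. *)
Lemma hom_density_cvg (F : graph) :
  (fun n => hom_density R F (G n)) @ \oo --> graphon_density F (W_mu mu).
Proof.
under eq_fun do rewrite (hom_density_integral _ _ (proj1 (sG _))).
rewrite /graphon_density Rintegral_mkcond.
set k := order_graph F.
have mW : measurable_fun setT (@edge_product R F (measurableTypeR R) (W_mu mu)).
  by apply: measurable_edge_product; exact: measurable_W_mu.
have W01 p : 0 <= W_mu mu p <= 1.
  by rewrite /W_mu indicE; case: (_ \in _); rewrite ?lexx ler01.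
have A01 n p : 0 <= @adjacency R (G n) p <= 1.
  by rewrite /adjacency; case: adj; rewrite ?lexx ler01.
apply: (@bounded_convergence _ (k.-tuple (measurableTypeR R)) R (cube_measure R k) _ _ 1).
- move=> n; have [ps _] := sG n.
  apply: (@measurable_fun_finite _ _ _ _ (map_tuple (vertex_at (s n)))
    (edge_product (@adjacency R (G n)))) => u.
  by have [] := @tuple_prob_map _ _ R (unif R) k _ _ _
    (@measurable_vertex_at R _ (s n)) (@unif_vertex_at R _ _ ps) u.
- have mr := (@measurable_restrictT _ _ _ (measurableTypeR R) _ _
    (@measurable_unit_cube k)).1 (measurable_funTS mW). exact: mr.
- move=> n t.
  have /andP[? ?] := edge_product_itv (map_tuple (vertex_at (s n)) t) (A01 n).
  by rewrite ger0_norm.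
- move=> t; rewrite patchE; case: ifP => _; last by rewrite normr0.
  by have /andP[? ?] := @edge_product_itv F _ _ t W01; rewrite ger0_norm.
- have := cube_edges F measurable_exceptional exceptional_null; have := cube_mem01 k.
  apply: filterS2 => t t01 tN; rewrite patchE mem_set; last first.
    by move=> i; have /andP[-> /ltW] := t01 i.
  apply: cvg_near_cst.
  have : \forall n \near \oo, forall e : vertex F * vertex F, (e.1 < e.2)%N ->
     adjacency R (vertex_at (s n) (tnth t e.1), vertex_at (s n) (tnth t e.2)) =
     W_mu mu (tnth t e.1, tnth t e.2).
    apply: filter_forall => e; have [e12|e12] := boolP (e.1 < e.2)%N; last exact: nearW.
    have := near_adj_W_mu (t01 e.1) (t01 e.2) (tN e e12).
    by apply: filterS.
  apply: filterS => n nW; apply: eq_bigr => e /andP[e12 _].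
  by rewrite !tnth_map nW.
Qed.

End density_limit.

(** * Polynomials close to the indicator of an interval *)

Section cutoff_polynomials.
Context (R : realType).

Lemma bernoulli_lower (t : R) k : 0 <= t <= 1 -> 1 - k%:R * t <= (1 - t) ^+ k.
Proof.
move=> /andP[t0 t1]; elim: k => [|k IH]; first by rewrite mul0r subr0 expr0.
have h : 0 <= k%:R * t ^+ 2 by rewrite mulr_ge0// exprn_ge0.
rewrite exprS; apply: (@le_trans _ _ ((1 - t) * (1 - k%:R * t))).
  by move: h; rewrite -natr1 expr2; nra.
by rewrite ler_wpM2l// subr_ge0.
Qed.

Lemma bernoulli_upper (t : R) k : 0 <= t <= 1 -> (1 - t) ^+ k * (1 + k%:R * t) <= 1.
Proof.
move=> /andP[t0 t1]; elim: k => [|k IH]; first by rewrite mul0r addr0 mulr1 expr0.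
apply: le_trans IH; rewrite exprSr -mulrA ler_wpM2l ?exprn_ge0 ?subr_ge0//.
have h : 0 <= k%:R * t ^+ 2 by rewrite mulr_ge0// exprn_ge0.
have h2 : 0 <= t ^+ 2 by rewrite exprn_ge0.
move: h h2; rewrite -natr1 expr2; nra.
Qed.

(** For large [m] this is close to [1] on [[0, a]] when [a < c] and close to [0]
    on [[b, 1]] when [c < b]: [c^-m * t^m] tends to [0] or to infinity according
    to the side of [c] on which [t] lies. *)
Definition cutoff (c : R) (m : nat) : {poly R} :=
  (1 - 'X^m) ^+ Num.truncn (c^-1 ^+ m).

Lemma cutoffE c m x : (cutoff c m).[x] = (1 - x ^+ m) ^+ Num.truncn (c^-1 ^+ m).
Proof. by rewrite /cutoff !hornerE. Qed.

Lemma cutoff_itv c m x : 0 <= x <= 1 -> 0 <= (cutoff c m).[x] <= 1.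
Proof.
move=> /andP[x0 x1]; rewrite cutoffE.
have xm0 : 0 <= x ^+ m by rewrite exprn_ge0.
have xm1 : x ^+ m <= 1 by rewrite exprn_ile1.
by rewrite exprn_ge0 ?subr_ge0// exprn_ile1 ?subr_ge0// gerBl.
Qed.

Lemma cutoff_lower (a c x : R) m : 0 < c -> 0 <= x <= a -> x <= 1 ->
  1 - (a / c) ^+ m <= (cutoff c m).[x].
Proof.
move=> c0 /andP[x0 xa] x1; rewrite cutoffE.
have xm0 : 0 <= x ^+ m by rewrite exprn_ge0.
have xm1 : x ^+ m <= 1 by rewrite exprn_ile1.
apply: le_trans (bernoulli_lower _ _); last by rewrite xm0.
rewrite lerD2l lerN2 expr_div_n -exprVn mulrC ler_pM//.
  by rewrite lerXn2r ?nnegrE// (le_trans x0).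
have cV : 0 <= c^-1 ^+ m by rewrite exprn_ge0// invr_ge0 ltW.
by have /andP[] := truncn_itv cV.
Qed.

Lemma cutoff_upper (b c x : R) m : 0 < c -> c <= b -> b <= x <= 1 ->
  (cutoff c m).[x] <= (c / b) ^+ m.
Proof.
move=> c0 cb /andP[bx x1]; rewrite cutoffE.
have b0 : 0 < b by exact: lt_le_trans cb.
have x0 : 0 < x by exact: lt_le_trans bx.
have xm0 : 0 <= x ^+ m by rewrite exprn_ge0// ltW.
have xm1 : x ^+ m <= 1 by rewrite exprn_ile1// ltW.
have cV : 0 <= c^-1 ^+ m by rewrite exprn_ge0// invr_ge0 ltW.
have /andP[_] := truncn_itv cV; rewrite -natr1.
set K := Num.truncn _ => cK.
have bc0 : 0 < (b / c) ^+ m by rewrite exprn_gt0// divr_gt0.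
(* Rounding down to [K] loses less than [1], hence at most [x^m <= 1] here. *)
have bcx : (b / c) ^+ m <= 1 + K%:R * x ^+ m.
  apply: (@le_trans _ _ (c^-1 ^+ m * x ^+ m)).
    rewrite expr_div_n -exprVn mulrC ler_wpM2l//.
    by rewrite lerXn2r ?nnegrE//; [exact: ltW|exact: ltW].
  apply: (@le_trans _ _ ((K%:R + 1) * x ^+ m)); first by rewrite ler_wpM2r// ltW.
  by rewrite mulrDl mul1r addrC lerD2r.
have -> : (c / b) ^+ m = ((b / c) ^+ m)^-1 by rewrite -exprVn invf_div.
rewrite -[leRHS]mul1r ler_pdivlMr//.
apply: (@le_trans _ _ ((1 - x ^+ m) ^+ K * (1 + K%:R * x ^+ m))).
  by rewrite ler_wpM2l// exprn_ge0// subr_ge0.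
by apply: bernoulli_upper; rewrite xm0.
Qed.

End cutoff_polynomials.

(** * Convergence of moments *)

Section moment_limit.
Context (R : realType).
Context (G : nat -> graph) (s : forall n, seq (vertex (G n))).
Hypothesis sG : forall n, nested_order (s n).
Local Notation q n := (@degree_at R (G n) (s n)).
Hypothesis cvg_star : forall k, cvgn (fun n => hom_density R (star k) (G n)).

Lemma horner_degree_at (p : {poly R}) n :
  \int[unif R]_x p.[q n x] = \sum_(k < size p) p`_k * hom_density R (star k) (G n).
Proof.
have [ps _] := sG n.
rewrite (@integral_vertex_at R _ (s n) ps
  (fun i => p.[(deg i)%:R / (order_graph (G n))%:R])).
under eq_bigr do rewrite horner_coef.
rewrite exchange_big mulr_sumr /=; apply: eq_bigr => k _.
by rewrite hom_density_star -mulr_sumr mulrCA.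
Qed.

(** The limit of the integral of [p] against the degree distributions. *)
Definition limit_moment (p : {poly R}) : R :=
  \sum_(k < size p) p`_k * limn (fun n => hom_density R (star k) (G n)).

Lemma cvg_horner (p : {poly R}) :
  (fun n => \int[unif R]_x p.[q n x]) @ \oo --> limit_moment p.
Proof.
under eq_fun do rewrite horner_degree_at.
apply: cvg_big => [|k _]; first exact: add_continuous.
apply: cvgMl_tmp; exact: cvg_star.
Qed.

Lemma integrable_indic_itv (a b : R) :
  (unif R).-integrable setT (EFin \o \1_(`[a, b[%classic : set R)).
Proof.
apply: (@bounded_integrable _ (measurableTypeR R) _ (unif R) _ 1).
  exact: measurable_indic.
by move=> x; rewrite indicE; case: (_ \in _); rewrite ?normr1 ?normr0 ?ler01.
Qed.

Lemma unif_indic (a b : R) : 0 <= a -> a <= b -> b <= 1 ->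
  \int[unif R]_t \1_(`[a, b[%classic : set R) t = b - a.
Proof.
move=> a0 ab b1; rewrite /Rintegral integral_indic// setIT.
by rewrite [X in fine X]unif_itv.
Qed.

(** Since the degree function is nondecreasing, a bound for [p] on degrees up to
    that at [x] gives a bound for the integrand on [[0, x)]. *)
Lemma integral_horner_ge (p : {poly R}) n (x e : R) :
  (forall t, 0 <= t <= 1 -> 0 <= p.[t] <= 1) -> 0 <= x < 1 ->
  (forall t, 0 <= t <= q n x -> e <= p.[t]) ->
  e * x <= \int[unif R]_t p.[q n t].
Proof.
move=> p01 x01 xe.
have [x0 x1] := andP x01.
have pq t : 0 <= p.[q n t] <= 1 by apply: p01; exact: degree_at01.
have mp : measurable_fun setT (fun t => p.[q n t]).
  exact: (@measurable_fun_finite _ _ _ _ (vertex_at (s n))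
    (fun i => p.[(deg i)%:R / (order_graph (G n))%:R]) (@measurable_vertex_at R _ (s n))).
have <- : \int[unif R]_t (e * \1_(`[0, x[%classic : set R) t) = e * x.
  by rewrite RintegralZl//; [rewrite unif_indic ?(ltW x1)// subr0|exact: integrable_indic_itv].
apply: le_Rintegral => //.
- exact: (@integrableZl _ _ _ (unif R) setT measurableT e _ (integrable_indic_itv 0 x)).
- apply: (@bounded_integrable _ (measurableTypeR R) _ (unif R) _ 1) => // t.
  by have /andP[p0 p1] := pq t; rewrite ger0_norm.
- move=> t _; rewrite indicE; have [|_] := boolP (t \in _).
    rewrite inE/= in_itv/= mulr1 => /andP[t0 tx]; apply: xe.
    have /andP[-> _] /= := @degree_at01 R _ (s n) t.
    rewrite ler_pM2r ?invr_gt0 ?ltr0n ?order_graph_gt0// ler_nat.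
    by apply: (deg_vertex_at_le (sG n)); rewrite ?t0 ?ltW.
  by rewrite mulr0; case/andP: (pq t).
Qed.


(** The complement of [[x, 1)] has mass [x] and the integrand is at most [1]
    there. *)
Lemma integral_horner_le (p : {poly R}) n (x e : R) :
  (forall t, 0 <= t <= 1 -> 0 <= p.[t] <= 1) -> 0 <= x < 1 -> 0 <= e ->
  (forall t, q n x <= t <= 1 -> p.[t] <= e) ->
  \int[unif R]_t p.[q n t] <= x + e.
Proof.
move=> p01 x01 e0 xe.
have [x0 x1] := andP x01.
have pq t : 0 <= p.[q n t] <= 1 by apply: p01; exact: degree_at01.
have mp : measurable_fun setT (fun t => p.[q n t]).
  exact: (@measurable_fun_finite _ _ _ _ (vertex_at (s n))
    (fun i => p.[(deg i)%:R / (order_graph (G n))%:R]) (@measurable_vertex_at R _ (s n))).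
have icst : (unif R).-integrable setT (EFin \o cst (1 + e)).
  exact: finite_measure_integrable_cst.
(* The indicator of [[x, 1)] is subtracted so that the bound also holds outside
   [[0,1)]. *)
have <- : \int[unif R]_t ((1 + e) - \1_(`[x, 1[%classic : set R) t) = x + e.
  rewrite RintegralB//; last exact: integrable_indic_itv.
  by rewrite unif_indic ?(ltW x1)// Rintegral_cst// [X in fine X]probability_setT /=; lra.
apply: le_Rintegral => //.
- apply: (@bounded_integrable _ (measurableTypeR R) _ (unif R) _ 1) => // t.
  by have /andP[p0 p1] := pq t; rewrite ger0_norm.
- exact: (@integrableB _ _ _ (unif R) setT measurableT _ _ icst (integrable_indic_itv x 1)).
- move=> t _; rewrite indicE; have [|_] := boolP (t \in _).
    rewrite inE/= in_itv/= => /andP[xt t1]; rewrite addrAC subrr add0r; apply: xe.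
    have /andP[_ ->] /= := @degree_at01 R _ (s n) t; rewrite andbT.
    rewrite ler_pM2r ?invr_gt0 ?ltr0n ?order_graph_gt0// ler_nat.
    by apply: (deg_vertex_at_le (sG n)); rewrite ?x0.
  by rewrite subr0; have /andP[_ p1] := pq t; lra.
Qed.


(** The number [x] is the mass of the positions before [x]. If the degree at [x]
    is infinitely often less than [a < c], the integral of the cutoff at [c] is
    infinitely often almost at least [x]; if it is infinitely often greater than
    [b > c], the integral is infinitely often almost at most [x]. As the
    integrals converge, both bounds pass to the limit. *)
Lemma limit_moment_cutoff (x a b c : R) : 0 <= x < 1 -> a < c -> c < b ->
  ~ (\forall n \near \oo, a <= q n x) -> ~ (\forall n \near \oo, q n x <= b) ->
  (fun m => limit_moment (cutoff c m)) @ \oo --> x.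
Proof.
move=> x01 ac cb nlow nhigh.
have [x0 x1] := andP x01.
have q01 n := @degree_at01 R _ (s n) x.
have a0 : 0 < a.
  rewrite ltNge; apply/negP => a0; apply: nlow; apply: nearW => n.
  by apply: (le_trans a0); case/andP: (q01 n).
have c0 : 0 < c by exact: lt_trans ac.
have b0 : 0 < b by exact: lt_trans cb.
have ac1 : `|a / c| < 1 by rewrite ger0_norm ?divr_ge0 ?ltW// ltr_pdivrMr// mul1r.
have cb1 : `|c / b| < 1 by rewrite ger0_norm ?divr_ge0 ?ltW// ltr_pdivrMr// mul1r.
have low m : (1 - (a / c) ^+ m) * x <= limit_moment (cutoff c m).
  rewrite leNgt; apply/negP => Llow; apply: nlow.
  have Llow' := @cvgr_lt _ _ _ eventually_filter _ _ (@cvg_horner (cutoff c m)) _ Llow.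
  near=> n; rewrite leNgt; apply/negP => /ltW qa.
  suff : (1 - (a / c) ^+ m) * x <= \int[unif R]_t (cutoff c m).[q n t].
    by apply/negP; rewrite -ltNge; near: n.
  apply: integral_horner_ge => //; first exact: cutoff_itv.
  move=> t /andP[t0 tq]; apply: cutoff_lower => //.
    by rewrite t0 (le_trans tq).
  by apply: (le_trans tq); case/andP: (q01 n).
have high m : limit_moment (cutoff c m) <= x + (c / b) ^+ m.
  rewrite leNgt; apply/negP => Lhigh; apply: nhigh.
  have Lhigh' := @cvgr_gt _ _ _ eventually_filter _ _ (@cvg_horner (cutoff c m)) _ Lhigh.
  near=> n; rewrite leNgt; apply/negP => /ltW qb.
  suff : \int[unif R]_t (cutoff c m).[q n t] <= x + (c / b) ^+ m.
    by apply/negP; rewrite -ltNge; near: n.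
  apply: integral_horner_le => //.
  - exact: cutoff_itv.
  - by rewrite exprn_ge0// divr_ge0 ?ltW.
  - move=> t /andP[qt t1]; apply: cutoff_upper => //; first exact: ltW.
    by rewrite t1 andbT (le_trans qb).
apply: (@squeeze_cvgr _ _ _ _ (fun m => (1 - (a / c) ^+ m) * x)
  (fun m => x + (c / b) ^+ m)).
- by apply: nearW => m; rewrite low high.
- have : (fun m => (1 - (a / c) ^+ m) * x) @ \oo --> (1 - 0) * x.
    apply: cvgM; last exact: cvg_cst.
    apply: cvgB; [exact: cvg_cst|exact: cvg_expr].
  by rewrite subr0 mul1r.
- have : (fun m => x + (c / b) ^+ m) @ \oo --> x + 0.
    by apply: cvgD; [exact: cvg_cst|exact: cvg_expr].
  by rewrite addr0.
Unshelve. all: by end_near. Qed.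

End moment_limit.

(** * Weak limits of degree distributions *)

(** The limit is the supremum of the eventual lower bounds. *)
Lemma cvgn_non_oscillating (R : realType) (u : nat -> R) :
  (forall n, 0 <= u n <= 1) ->
  (forall a b, a < b ->
    (\forall n \near \oo, a <= u n) \/ (\forall n \near \oo, u n <= b)) ->
  cvgn u.
Proof.
move=> u01 osc.
pose S := [set z : R | \forall n \near \oo, z <= u n].
have S0 : S 0 by apply: nearW => n; case/andP: (u01 n).
have Sub : has_ubound S.
  exists 1 => z [N _ /(_ N (leqnn N))] /= /le_trans; apply.
  by case/andP: (u01 N).
have supS : has_sup S by split => //; exists 0.
apply/cvg_ex; exists (sup S); apply/cvgrPdist_le => e e0.
have [z Sz ze] := sup_adherent e0 supS.
have high : \forall n \near \oo, u n <= sup S + e.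
  have [|Se|//] := osc (sup S + e / 2) (sup S + e); first lra.
  have := ub_le_sup Sub Se; lra.
move: Sz high; apply: filterS2 => n zn nh.
by rewrite ler_norml; move: ze zn nh; lra.
Qed.

Section weak_limit.
Context (R : realType).
Context (G : nat -> graph) (s : forall n, seq (vertex (G n))).
Hypothesis sG : forall n, nested_order (s n).
Local Notation q n := (@degree_at R (G n) (s n)).
Hypothesis cvg_star : forall k, cvgn (fun n => hom_density R (star k) (G n)).

(** By [limit_moment_cutoff] this contains every point of [[0,1)] at which the
    degree functions diverge; the limit in the definition has a junk value for
    those [c] for which the sequence diverges. *)
Definition oscillation_set : set R :=
  range (fun c : rat => limn (fun m => limit_moment G (cutoff (ratr c : R) m))).

Definition steady : set (measurableTypeR R) := `[0, 1[%classic `\` oscillation_set.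

Lemma countable_oscillation_set : countable oscillation_set.
Proof. by apply: sub_countable (card_image_le _ _) _; exact: countableP. Qed.

Lemma measurable_steady : measurable steady.
Proof.
apply: measurableD; first exact: measurable_itv.
apply: countable_measurable => //.
exact: countable_oscillation_set.
Qed.

Lemma cvgn_degree_at x : steady x -> cvgn (fun n => q n x).
Proof.
move=> [/= + nosc]; rewrite in_itv/= => x01.
apply: cvgn_non_oscillating => [n|a b ab]; first exact: degree_at01.
apply: contrapT => /not_orP[nlow nhigh]; apply: nosc.
have [c] := rat_in_itvoo ab; rewrite in_itv/= => /andP[ac cb].
exists c => //; apply: cvg_lim => //.
exact: (limit_moment_cutoff sG cvg_star x01 ac cb nlow nhigh).
Qed.

(** Extended by [0], which keeps the values in [[0,1]] everywhere. *)
Definition limit_degree (x : R) : R :=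
  ((fun x => limn (fun n => q n x)) \_ steady) x.

Lemma limit_degree_cvg x : steady x -> (fun n => q n x) @ \oo --> limit_degree x.
Proof.
by move=> xs; rewrite /limit_degree patchE mem_set//; exact: cvgn_degree_at.
Qed.

Lemma measurable_limit_degree : measurable_fun setT limit_degree.
Proof.
have m1 : measurable_fun steady (fun x => limn (fun n => q n x)).
  apply: (@measurable_fun_cvg _ (measurableTypeR R) R steady (fun n => q n)).
    by move=> n; apply: measurable_funTS; exact: measurable_degree_at.
  by move=> x xs; exact: cvgn_degree_at.
exact: (@measurable_restrictT _ _ (measurableTypeR R) (measurableTypeR R) _ _
  measurable_steady).1 m1.
Qed.

Lemma limit_degree01 x : 0 <= limit_degree x <= 1.
Proof.
rewrite /limit_degree patchE; case: ifPn => [|_]; last by rewrite lexx ler01.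
rewrite inE => /cvgn_degree_at cq.
apply/andP; split; [apply: limr_ge => //|apply: limr_le => //]; apply: nearW => n;
  by case/andP: (@degree_at01 R _ (s n) x).
Qed.

Definition limit_law : probability (measurableTypeR R) R :=
  distribution (unif R) (@mfun_Sub _ _ (measurableTypeR R) (measurableTypeR R)
    limit_degree (mem_set measurable_limit_degree)).

Lemma limit_law_support : limit_law (`[0, 1]%classic : set R) = 1%E.
Proof.
rewrite -[RHS](probability_setT (unif R)); congr (unif R _).
apply/seteqP; split => // x _ /=.
by rewrite in_itv/= limit_degree01.
Qed.

Definition limit_distribution : prob01 R := Prob01 limit_law_support.

Lemma ae_steady : (unif R).-negligible (~` steady).
Proof.
apply: negligibleS (negligibleU (unif_mem01 R)
  (unif_countable countable_oscillation_set)).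
move=> x /not_andP[x01|/contrapT]; last by right.
by left => /= h; apply: x01; rewrite /= in_itv.
Qed.

(** Both sides are integrals over the same probability space, of [f] composed
    with degree functions which converge almost everywhere. *)
Lemma weak_limit :
  weakly_converges (fun n => degree_distribution R (G n)) limit_distribution.
Proof.
move=> f cf.
rewrite (@Rintegral_image _ limit_distribution limit_degree)//; last first.
- exact: limit_degree01.
- exact: measurable_limit_degree.
under eq_fun => n.
  have [ps _] := sG n; rewrite (integral_degree_distribution ps cf); over.
have mf : measurable_fun (`[0, 1]%classic : set R) f.
  exact: subspace_continuous_measurable_fun.
pose f' := f \_ (`[0, 1]%classic : set R).
have mf' : measurable_fun setT f'.
  exact: (@measurable_restrictT _ _ (measurableTypeR R) (measurableTypeR R) _ f
    (measurable_itv _)).1 mf.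
have ff' t : 0 <= t <= 1 -> f t = f' t.
  by move=> t01; rewrite /f' patchE mem_set//= in_itv.
have [M fM] := continuous01_bounded cf.
apply: (@bounded_convergence _ (measurableTypeR R) R (unif R) _ _ M).
- move=> n; have -> : (fun x => f (q n x)) = f' \o q n.
    by apply/funext => x /=; rewrite ff' ?degree_at01.
  apply: measurableT_comp => //; exact: measurable_degree_at.
- have -> : (fun x => f (limit_degree x)) = f' \o limit_degree.
    by apply/funext => x /=; rewrite ff' ?limit_degree01.
  apply: measurableT_comp => //; exact: measurable_limit_degree.
- by move=> n x; apply: fM; exact: degree_at01.
- by move=> x; apply: fM; exact: limit_degree01.
- apply: negligibleS ae_steady => x; apply: contra_not => xs.
  have := (subspace_continuousP _ _).1 cf (limit_degree x).
  rewrite /= in_itv/= limit_degree01 => /(_ isT) cfx.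
  apply: (cvg_comp _ _ _ cfx) => P /= /(limit_degree_cvg xs) nP.
  have {}nP : \forall n \near \oo, `[0, 1]%classic (q n x) -> P (q n x) := nP.
  by apply: filterS nP => n; apply; rewrite /= in_itv/= degree_at01.
Qed.

End weak_limit.

(** * Convergence of threshold graphs *)

Theorem theorem5p5 (R : realType) (G : nat -> graph)
    (G_threshold : forall n, threshold_graph R (G n))
    (G_order : (fun n => order_graph (G n)) @ \oo --> \oo) :
  let nuG := fun n => degree_distribution R (G n) in
  let G_converges_to := fun Gamma : graph_space R =>
    (fun n => embed R (unlabeled (G n))) @ \oo --> Gamma in
  ((exists2 Gamma, Ubar R Gamma & G_converges_to Gamma) <->
   (exists mu : prob01 R, weakly_converges nuG mu)) /\
  (forall mu : prob01 R, weakly_converges nuG mu ->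
    [/\ P_s mu, Uinfty R (Gamma_mu mu) & G_converges_to (Gamma_mu mu)]).
Proof.
move=> nuG G_converges_to.
pose s n := projT1 (cid (threshold_nested_order (G_threshold n))).
have sG n : nested_order (s n) := projT2 (cid (threshold_nested_order (G_threshold n))).
have weak_to_limit mu : weakly_converges nuG mu ->
    [/\ P_s mu, Uinfty R (Gamma_mu mu) & G_converges_to (Gamma_mu mu)].
  move=> nu_mu.
  have Gmu : G_converges_to (Gamma_mu mu).
    apply/embed_cvgP; split=> [F|]; first exact: (hom_density_cvg sG G_order nu_mu).
    apply/cvgrPdist_le => e e0; move: (order_inv_le G_order e0).
    by apply: filterS => n; rewrite sub0r normrN ger0_norm ?invr_ge0.
  split => //; first exact: (P_s_limit sG G_order nu_mu).
  split.
    apply: (closed_cvg (Ubar R) _ _ _ Gmu); first exact: closed_closure.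
    by apply: nearW => n; apply: subset_closure; exists (unlabeled (G n)).
  move=> [F _ /(congr1 snd) /= /eqP]; rewrite invr_eq0 pnatr_eq0.
  by apply/negP; rewrite -lt0n order_graph_gt0.
split; last exact: weak_to_limit.
split=> [[Gamma _ /embed_cvgP[cG _]]|[mu nu_mu]]; last first.
  have [_ [Ubar_mu _] Gmu] := weak_to_limit mu nu_mu.
  by exists (Gamma_mu mu).
have cvg_star k : cvgn (fun n => hom_density R (star k) (G n)).
  apply/cvg_ex; exists (Gamma.1 (unlabeled (star k))).
  have := cG (unlabeled (star k)).
  under eq_fun do rewrite (hom_density_isomorphic R
    (representative_unlabeled (star k)) (isomorphic_refl _)).
  by [].
by exists (limit_distribution sG cvg_star); exact: weak_limit.
Qed.
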